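(* Suppose the weighted composition operators $C_{\phi_1,\omega_1}$ and $C_{\phi_2,\omega_2}$ in $L^2(\mu)$ are densely defined, and fix $\lambda\in[0,1]$. Write $H=h_{\phi_1,\omega_1}+h_{\phi_2,\omega_2}$. Then the $\lambda$-spherical mean transform $\mathcal{M}_\lambda(\mathbf{C}_{\phi,\omega})$ of $\mathbf{C}_{\phi,\omega}=(C_{\phi_1,\omega_1},C_{\phi_2,\omega_2})$ satisfies: (i) $\mathcal{D}(\mathcal{M}_\lambda(\mathbf{C}_{\phi,\omega}))=L^2\Big(\big(1+\sum_{i=1}^2(h_{\phi_i,\omega_i}+\mathsf{E}_i)\big)d\mu\Big)$; (ii) $\overline{\mathcal{D}(\mathcal{M}_\lambda(\mathbf{C}_{\phi,\omega}))}=\chi_{\{\sum_{i=1}^2E_{\phi_i,\omega_i}(H)\circ\phi_i^{-1}<\infty\}}\cdot L^2(\mu)$; (iii) $\mathcal{D}(\mathcal{M}_\lambda(\mathbf{C}_{\phi,\omega}))^\perp=\chi_{\{\sum_{i=1}^2E_{\phi_i,\omega_i}(H)\circ\phi_i^{-1}=\infty\}}\cdot L^2(\mu)$; (iv) $\mathcal{M}_\lambda(\mathbf{C}_{\phi,\omega})=(C_{\phi_1,\omega_\lambda^1},C_{\phi_2,\omega_\lambda^2})$ if $\lambda\in(0,1)$, and $\mathcal{M}_\lambda(\mathbf{C}_{\phi,\omega})\subseteq(C_{\phi_1,\omega_\lambda^1},C_{\phi_2,\omega_\lambda^2})$ if $\lambda\in\{0,1\}$.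
   Context: $(X,\mathscr{A},\mu)$ is a $\sigma$-finite measure space and $L^2(\mu)$ is the complex Hilbert space. For an $\mathscr{A}$-measurable transformation $\phi:X\to X$ and an $\mathscr{A}$-measurable $\omega:X\to\mathbb{C}$, put $\mu_\omega(\Delta)=\int_\Delta|\omega|^2d\mu$. The weighted composition operator $C_{\phi,\omega}$ in $L^2(\mu)$ has domain $\mathcal{D}(C_{\phi,\omega})=\{f\in L^2(\mu):\omega\cdot(f\circ\phi)\in L^2(\mu)\}$ and acts by $C_{\phi,\omega}f=\omega\cdot(f\circ\phi)$. It is always assumed that $\mu_\omega\circ\phi^{-1}\ll\mu$ (so $C_{\phi,\omega}$ is well-defined); this is automatic for $C_{\phi_i,\omega^i_\lambda}$ below. $h_{\phi,\omega}:X\to[0,\infty]$ is the ($\mu$-a.e. unique) measurable function with $\mu_\omega(\phi^{-1}(\Delta))=\int_\Delta h_{\phi,\omega}\,d\mu$ for all $\Delta\in\mathscr{A}$. If $C_{\phi,\omega}$ is densely defined, then $\mu_\omega|_{\phi^{-1}(\mathscr{A})}$ is $\sigma$-finite, and for measurable $f:X\to[0,\infty]$, $E_{\phi,\omega}(f)$ is the ($\mu_\omega$-a.e. unique) $\phi^{-1}(\mathscr{A})$-measurable $[0,\infty]$-valued function with $\int_{\phi^{-1}(\Delta)}f\,d\mu_\omega=\int_{\phi^{-1}(\Delta)}E_{\phi,\omega}(f)\,d\mu_\omega$ for all $\Delta\in\mathscr{A}$. $E_{\phi,\omega}(f)\circ\phi^{-1}$ denotes the ($\mu$-a.e. unique)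 $\mathscr{A}$-measurable function on $X$ that vanishes $\mu$-a.e. on $\{h_{\phi,\omega}=0\}$ and satisfies $(E_{\phi,\omega}(f)\circ\phi^{-1})\circ\phi=E_{\phi,\omega}(f)$ a.e. $[\mu_\omega]$. For measurable $\rho:X\to[1,\infty]$, $L^2(\rho\,d\mu)=\{f\in L^2(\mu):\int_X|f|^2\rho\,d\mu<\infty\}$, with $0\cdot\infty=0$. A pair $\mathbf{T}=(T_1,T_2)$ of operators in $L^2(\mu)$ is identified with the column operator $f\mapsto\binom{T_1f}{T_2f}$ with domain $\mathcal{D}(\mathbf{T})=\mathcal{D}(T_1)\cap\mathcal{D}(T_2)$; $\mathbf{T}\subseteq\mathbf{S}$ means $\mathcal{D}(\mathbf{T})\subseteq\mathcal{D}(\mathbf{S})$ and $T_if=S_if$ for $f\in\mathcal{D}(\mathbf{T})$, $i=1,2$; equality of pairs means inclusion both ways. If $C_{\phi_1,\omega_1},C_{\phi_2,\omega_2}$ are densely defined, the column operator $\mathbf{C}_{\phi,\omega}$ is densely defined and closed; let $\mathbf{C}_{\phi,\omega}=\binom{U_1}{U_2}|\mathbf{C}_{\phi,\omega}|$ be its polar decomposition. The $\lambda$-spherical mean transform is $$\mathcal{M}_\lambda(\mathbf{C}_{\phi,\omega})=\big(\lambda U_1|\mathbf{C}_{\phi,\omega}|+(1-\lambda)|\mathbf{C}_{\phi,\omega}|U_1,\ \lambda U_2|\mathbf{C}_{\phi,\omega}|+(1-\lambda)|\mathbf{C}_{\phi,\omega}|U_2\big),$$ where for every $\lambda\in[0,1]$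 (including the endpoints) the $i$th component has domain $\mathcal{D}(U_i|\mathbf{C}_{\phi,\omega}|)\cap\mathcal{D}(|\mathbf{C}_{\phi,\omega}|U_i)$. With $H=h_{\phi_1,\omega_1}+h_{\phi_2,\omega_2}$: $\mathsf{E}_i=\big(E_{\phi_i,\omega_i}(H)\circ\phi_i^{-1}\big)\cdot\dfrac{h_{\phi_i,\omega_i}\,\chi_{\{H>0\}}}{H}$ (a $[0,\infty]$-valued function, equal to $0$ where $H=0$), and $\omega_\lambda^i=(\eta_i+\lambda(1-\eta_i))\,\omega_i$ a.e. $[\mu]$ with $\eta_i=\chi_{\{\omega_i\neq0\}}\big(\frac{H}{H\circ\phi_i}\big)^{1/2}$ (meaningful since $\mu(\{\omega_i\ne0\}\cap\{H\circ\phi_i=0\})=0$). *)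

(* Defs.v *)
From HB Require Import structures.
From mathcomp Require Import all_boot all_order all_algebra.
From mathcomp Require Import generic_quotient ring_quotient.
From mathcomp Require Import all_classical all_reals all_analysis.
From mathcomp Require Import measurable_realfun lebesgue_Rintegral.
From mathcomp Require Export complex.
From mathcomp Require Import ring lra.

Set Implicit Arguments.
Unset Strict Implicit.
Unset Printing Implicit Defensive.
Import Order.TTheory GRing.Theory Num.Theory.
Import numFieldNormedType.Exports.

Local Open Scope classical_set_scope.
Local Open Scope ring_scope.
Local Open Scope complex_scope.
Local Open Scope quotient_scope.

Local Notation Re := complex.Re.
Local Notation Im := complex.Im.

(** Complex inner product spaces; the inner product is linear in its first
    argument. *)

HB.mixin Record isInnerProduct (R : realType) E & GRing.Lmodule R[i] E := {
  inner : {dot E for (@Num.conj R[i])}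
}.

#[short(type="innerProductType")]
HB.structure Definition InnerProduct (R : realType) :=
  {E of isInnerProduct R E & GRing.Lmodule R[i] E}.

Section direct_sum.
Context {R : realType} (E F : innerProductType R).

Definition inner_pair (u v : E * F) : R[i] :=
  inner u.1 v.1 + inner u.2 v.2.

Fact inner_pair_bilinear :
  bilinear_for *%R (Num.conj \; *%R) inner_pair.
Proof.
split=> [v a x y|v a x y]; rewrite /inner_pair /=.
  by rewrite !linearPl /= mulrDr addrACA.
by rewrite !linearPr /= mulrDr addrACA.
Qed.

HB.instance Definition _ :=
  @bilinear_isBilinear.Build R[i] (E * F)%type (E * F)%type R[i] *%R
    (Num.conj \; *%R) inner_pair inner_pair_bilinear.

Fact inner_pair_herm x y :
  inner_pair x y = (-1) ^+ false * Num.conj (inner_pair y x).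
Proof.
rewrite /inner_pair expr0 mul1r rmorphD/=; congr (_ + _).
  by rewrite (hermitian_subproof (s := inner)) expr0 mul1r.
by rewrite (hermitian_subproof (s := inner)) expr0 mul1r.
Qed.

HB.instance Definition _ :=
  @isHermitianSesquilinear.Build R[i] (E * F)%type false Num.conj inner_pair
    inner_pair_herm.

Fact inner_pair_gt0 u : u != 0 -> 0 < inner_pair u u.
Proof.
case: u => u v; rewrite /inner_pair /=.
have [-> |u0 _] := eqVneq u 0; last by rewrite ltr_wpDr// ?dnorm_ge0 ?dnorm_gt0.
have [-> |v0 _] := eqVneq v 0; first by rewrite eqxx.
by rewrite ltr_wpDl// ?dnorm_ge0 ?dnorm_gt0.
Qed.

HB.instance Definition _ :=
  @isDotProduct.Build R[i] (E * F)%type inner_pair inner_pair_gt0.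

HB.instance Definition _ := @isInnerProduct.Build R (E * F)%type inner_pair.

End direct_sum.

Section complex_functions.
Context {R : realType} {d : measure_display} {X : measurableType d}.

Definition sqnorm (z : R[i]) : R := Re z ^+ 2 + Im z ^+ 2.

Definition cmeasurable (f : X -> R[i]) :=
  measurable_fun setT (fun x => Re (f x)) /\
  measurable_fun setT (fun x => Im (f x)).

Lemma sqnorm_ge0 z : 0 <= sqnorm z.
Proof. by rewrite /sqnorm addr_ge0 ?sqr_ge0. Qed.

Lemma ler_norm_addM (a b p q : R) :
  `|a * p + b * q| <= a ^+ 2 + b ^+ 2 + (p ^+ 2 + q ^+ 2).
Proof.
have := sqr_ge0 (a - p); have := sqr_ge0 (b - q).
have := sqr_ge0 (a + p); have := sqr_ge0 (b + q).
have := sqr_ge0 a; have := sqr_ge0 b; have := sqr_ge0 p; have := sqr_ge0 q.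
rewrite !sqrrD !sqrrN !mulrN ler_norml => ? ? ? ? ? ? ? ?; apply/andP; split; lra.
Qed.

Lemma measurable_sqnorm f :
  cmeasurable f -> measurable_fun setT (fun x => sqnorm (f x)).
Proof.
by move=> [mr mi]; apply: measurable_funD; apply: measurable_funX.
Qed.

End complex_functions.

Section L2_functions.
Context {R : realType} {d : measure_display} {X : measurableType d}.
Variable mu : {measure set X -> \bar R}.

Definition L2fun_pred : {pred X -> R[i]} := mem [set f : X -> R[i] |
  cmeasurable f /\ (\int[mu]_x (sqnorm (f x))%:E < +oo)%E].

Record L2fun := MkL2fun {
  L2fun_val :> X -> R[i];
  _ : L2fun_val \in L2fun_pred }.

HB.instance Definition _ := [isSub for L2fun_val].
HB.instance Definition _ := [Choice of L2fun by <:].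

Fact L2fun_submod_closed : submod_closed L2fun_pred.
Proof.
split=> [|a f g].
  rewrite inE; split; first by split; exact: measurable_cst.
  by rewrite integral0_eq// => x _; rewrite /sqnorm /= expr0n/= addr0.
rewrite !inE => -[[mrf mif] If] [[mrg mig] Ig].
have mfg : cmeasurable (a *: f + g).
  split.
    rewrite [X in measurable_fun _ X](_ : _ =
      fun x => (Re a * Re (f x) - Im a * Im (f x)) + Re (g x)).
      apply: measurable_funD => //.
      by apply: measurable_funB; exact: measurable_funM.
    by apply/funext => x /=; rewrite !fctE; case: a (f x) (g x) => [? ?] [? ?] [].
  rewrite [X in measurable_fun _ X](_ : _ =
    fun x => (Re a * Im (f x) + Im a * Re (f x)) + Im (g x)).
    apply: measurable_funD => //.
    by apply: measurable_funD; exact: measurable_funM.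
  by apply/funext => x /=; rewrite !fctE; case: a (f x) (g x) => [? ?] [? ?] [].
split=> //.
have mf : cmeasurable f by [].
have mg : cmeasurable g by [].
pose c := 2 * sqnorm a.
have c0 : 0 <= c by rewrite mulr_ge0 ?sqnorm_ge0.
apply: (@le_lt_trans _ _
  (\int[mu]_x (c%:E * (sqnorm (f x))%:E + 2%:E * (sqnorm (g x))%:E))%E).
  apply: ge0_le_integral => //.
  - by move=> x _; rewrite lee_fin sqnorm_ge0.
  - by apply/measurable_EFinP; exact: measurable_sqnorm.
  - apply: emeasurable_funD; apply: emeasurable_funM => //;
      by apply/measurable_EFinP; exact: measurable_sqnorm.
  - move=> x _; rewrite -!EFinM -EFinD lee_fin /c /sqnorm !fctE.
    case: a (f x) (g x) {c c0 mfg} => [a b] [p q] [r s] /=.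
    have h1 := sqr_ge0 (a * p - b * q - r).
    have h2 := sqr_ge0 (a * q + b * p - s).
    rewrite -subr_ge0.
    suff -> : 2 * (a ^+ 2 + b ^+ 2) * (p ^+ 2 + q ^+ 2) + 2 * (r ^+ 2 + s ^+ 2) -
      ((a * p - b * q + r) ^+ 2 + (a * q + b * p + s) ^+ 2) =
      (a * p - b * q - r) ^+ 2 + (a * q + b * p - s) ^+ 2 by rewrite addr_ge0.
    by ring.
rewrite ge0_integralD//=; last 4 first.
- by move=> x _; rewrite -EFinM lee_fin mulr_ge0 ?sqnorm_ge0.
- by apply: emeasurable_funM => //; apply/measurable_EFinP; exact: measurable_sqnorm.
- by move=> x _; rewrite -EFinM lee_fin mulr_ge0 ?sqnorm_ge0.
- by apply: emeasurable_funM => //; apply/measurable_EFinP; exact: measurable_sqnorm.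
rewrite !ge0_integralZl//=; last 4 first.
- by apply/measurable_EFinP; exact: measurable_sqnorm.
- by move=> x _; rewrite lee_fin sqnorm_ge0.
- by apply/measurable_EFinP; exact: measurable_sqnorm.
- by move=> x _; rewrite lee_fin sqnorm_ge0.
by rewrite lte_add_pinfty// lte_mul_pinfty// lee_fin.
Qed.

HB.instance Definition _ :=
  GRing.isSubmodClosed.Build R[i] (X -> R[i]) L2fun_pred L2fun_submod_closed.
HB.instance Definition _ := [SubChoice_isSubLmodule of L2fun by <:].

Definition L2null : {pred L2fun} :=
  mem [set f : L2fun | {ae mu, forall x, f x = 0}].

Fact L2null_zmod_closed : zmod_closed L2null.
Proof.
split; first by rewrite inE; apply/nearW => x.
move=> f g; rewrite !inE; apply: filterS2 => x f0 g0.
by rewrite -[LHS]/(f x - g x) f0 g0 subrr.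
Qed.

HB.instance Definition _ :=
  GRing.isZmodClosed.Build L2fun L2null L2null_zmod_closed.

End L2_functions.
Arguments L2null {R d X} mu.

Section L2_space.
Context {R : realType} {d : measure_display} {X : measurableType d}.
Variable mu : {measure set X -> \bar R}.

(** [L2 mu] is the space of a.e. classes; [L2_to_fun] is the coercion to the
    chosen representative. *)
Definition L2 : Type := Quotient.quot (L2null mu).
HB.instance Definition _ := GRing.Zmodule.on L2.
HB.instance Definition _ := EqQuotient.on L2.

Definition L2_to_fun (u : L2) : X -> R[i] := repr u : L2fun mu.
Coercion L2_to_fun : L2 >-> Funclass.

Lemma L2_piP (f g : L2fun mu) :
  \pi_L2 f = \pi_L2 g <-> {ae mu, forall x, f x = g x}.
Proof.
have -> : (\pi_L2 f = \pi_L2 g) <-> (f - g \in L2null mu).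
  by rewrite Quotient.idealrBE; split=> /eqP.
rewrite inE; split; apply: filterS => x.
  by rewrite -[X in X -> _]/(f x - g x = 0) => /eqP; rewrite subr_eq0 => /eqP.
by rewrite -[X in _ -> X]/(f x - g x = 0) => ->; rewrite subrr.
Qed.

Lemma L2_eqP (u v : L2) : u = v <-> {ae mu, forall x, u x = v x}.
Proof. by rewrite -L2_piP !reprK. Qed.

Lemma L2_reprP (f : L2fun mu) : {ae mu, forall x, (\pi_L2 f : L2) x = f x}.
Proof. by apply/L2_piP; rewrite reprK. Qed.

Lemma L2_measurable (u : L2) : cmeasurable u.
Proof. by rewrite /L2_to_fun; case: (repr u) => f /=; rewrite inE => -[]. Qed.

Lemma L2_fin (u : L2) : (\int[mu]_x (sqnorm (u x))%:E < +oo)%E.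
Proof. by rewrite /L2_to_fun; case: (repr u) => f /=; rewrite inE => -[]. Qed.

Lemma L2_piD (f g : L2fun mu) : \pi_L2 (f + g) = (\pi_L2 f : L2) + \pi_L2 g.
Proof. exact: (@Quotient.pi_add _ (L2null mu)). Qed.

Lemma L2_pi0 : \pi_L2 (0 : L2fun mu) = 0 :> L2.
Proof. by apply: (@addrI L2 (\pi_L2 0)); rewrite -L2_piD !addr0. Qed.

Lemma L2_addE (u v : L2) : {ae mu, forall x, (u + v : L2) x = u x + v x}.
Proof.
have <- : \pi_L2 ((repr u : L2fun mu) + repr v) = u + v by rewrite L2_piD !reprK.
exact: L2_reprP.
Qed.

Definition L2_scale (a : R[i]) (u : L2) : L2 := \pi_L2 (a *: (repr u : L2fun mu)).

Lemma L2_scaleE a u : {ae mu, forall x, L2_scale a u x = a * u x}.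
Proof. exact: L2_reprP. Qed.

Fact L2_scaleA a b u : L2_scale a (L2_scale b u) = L2_scale (a * b) u.
Proof.
apply/L2_eqP; move: (L2_scaleE a (L2_scale b u)) (L2_scaleE b u) (L2_scaleE (a * b) u).
by apply: filterS3 => x -> -> ->; rewrite mulrA.
Qed.

Fact L2_scale1 : left_id 1 L2_scale.
Proof.
by move=> u; apply/L2_eqP; apply: filterS (L2_scaleE 1 u) => x ->; rewrite mul1r.
Qed.

Fact L2_scaleDr : right_distributive L2_scale +%R.
Proof.
move=> a u v; rewrite /L2_scale -L2_piD; apply/L2_piP.
apply: filterS (L2_addE u v) => x h.
rewrite -[LHS]/(a * (u + v : L2) x) h mulrDr //.
Qed.

Fact L2_scaleDl u : {morph L2_scale^~ u : a b / a + b}.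
Proof. by move=> a b; rewrite /L2_scale -L2_piD -scalerDl. Qed.

HB.instance Definition _ := GRing.Zmodule_isLmodule.Build R[i] L2
  L2_scaleA L2_scale1 L2_scaleDr L2_scaleDl.

Lemma L2_linE a (u v : L2) : {ae mu, forall x, (a *: u + v : L2) x = a * u x + v x}.
Proof.
move: (L2_addE (a *: u) v) (L2_scaleE a u).
by apply: filterS2 => x -> ->.
Qed.

Lemma L2_intg_Re (u v : L2) :
  mu.-integrable setT (EFin \o (fun x => Re (u x * (v x)^*))).
Proof.
have [mur mui] := L2_measurable u; have [mvr mvi] := L2_measurable v.
have E x : Re (u x * (v x)^*) = Re (u x) * Re (v x) + Im (u x) * Im (v x).
  by case: (u x) (v x) => a b [p q] /=; ring.
have m : measurable_fun setT (fun x => Re (u x * (v x)^*)).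
  under eq_fun do rewrite E.
  by apply: measurable_funD; exact: measurable_funM.
apply/integrableP; split; first exact/measurable_EFinP.
apply: (@le_lt_trans _ _
   (\int[mu]_x ((sqnorm (u x))%:E + (sqnorm (v x))%:E))%E).
  apply: ge0_le_integral => //.
  - by apply: measurableT_comp => //; exact/measurable_EFinP.
  - by apply: emeasurable_funD; apply/measurable_EFinP;
      apply: measurable_sqnorm; exact: L2_measurable.
  - move=> x _ /=; rewrite lee_fin E /sqnorm.
    exact: ler_norm_addM.
rewrite ge0_integralD//; first by rewrite lte_add_pinfty// L2_fin.
all: by [move=> x _; rewrite lee_fin sqnorm_ge0 |
  apply/measurable_EFinP; apply: measurable_sqnorm; exact: L2_measurable].
Qed.

Lemma L2_intg_Im (u v : L2) :
  mu.-integrable setT (EFin \o (fun x => Im (u x * (v x)^*))).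
Proof.
have [mur mui] := L2_measurable u; have [mvr mvi] := L2_measurable v.
have E x : Im (u x * (v x)^*) = Im (u x) * Re (v x) - Re (u x) * Im (v x).
  by case: (u x) (v x) => a b [p q] /=; ring.
have m : measurable_fun setT (fun x => Im (u x * (v x)^*)).
  under eq_fun do rewrite E.
  by apply: measurable_funB; exact: measurable_funM.
apply/integrableP; split; first exact/measurable_EFinP.
apply: (@le_lt_trans _ _
   (\int[mu]_x ((sqnorm (u x))%:E + (sqnorm (v x))%:E))%E).
  apply: ge0_le_integral => //.
  - by apply: measurableT_comp => //; exact/measurable_EFinP.
  - by apply: emeasurable_funD; apply/measurable_EFinP;
      apply: measurable_sqnorm; exact: L2_measurable.
  - move=> x _ /=; rewrite lee_fin E /sqnorm.
    have := ler_norm_addM (Im (u x)) (Re (u x)) (Re (v x)) (- Im (v x)).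
    by rewrite mulrN sqrrN [X in _ <= X + _]addrC.
rewrite ge0_integralD//; first by rewrite lte_add_pinfty// L2_fin.
all: by [move=> x _; rewrite lee_fin sqnorm_ge0 |
  apply/measurable_EFinP; apply: measurable_sqnorm; exact: L2_measurable].
Qed.

Definition L2_inner (u v : L2) : R[i] :=
  (\int[mu]_x Re (u x * (v x)^*)) +i* (\int[mu]_x Im (u x * (v x)^*)).

Lemma ae_eq_Rintegral (f g : X -> R) :
  mu.-integrable setT (EFin \o f) -> mu.-integrable setT (EFin \o g) ->
  {ae mu, forall x, f x = g x} -> \int[mu]_x f x = \int[mu]_x g x.
Proof.
move=> /integrableP[mf _] /integrableP[mg _] fg; rewrite /Rintegral; congr fine.
apply: ae_eq_integral => //.
by apply: filterS fg => x /= -> _.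
Qed.

Fact L2_inner_herm u v :
  L2_inner u v = (-1) ^+ false * Num.conj (L2_inner v u).
Proof.
rewrite expr0 mul1r -[RHS]/((L2_inner v u)^*) /L2_inner /=; congr (_ +i* _).
  by apply: eq_Rintegral => x _; case: (u x) (v x) => a b [p q] /=; ring.
rewrite -mulN1r -RintegralZl//; last exact: L2_intg_Im.
by apply: eq_Rintegral => x _; case: (u x) (v x) => a b [p q] /=; ring.
Qed.

Lemma L2_inner_linear (v : L2) (a : R[i]) (u w : L2) :
  L2_inner (a *: u + w) v = a * L2_inner u v + L2_inner w v.
Proof.
have cr (f g : X -> R) (p q : R) : mu.-integrable setT (EFin \o f) ->
    mu.-integrable setT (EFin \o g) ->
    mu.-integrable setT (EFin \o (fun x => p * f x + q * g x)) /\
    \int[mu]_x (p * f x + q * g x) =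
    p * (\int[mu]_x f x) + q * (\int[mu]_x g x).
  move=> If Ig.
  have Ipf : mu.-integrable setT (EFin \o (fun x => p * f x)).
    by apply: eq_integrable (integrableZl measurableT p If) => // x _.
  have Iqg : mu.-integrable setT (EFin \o (fun x => q * g x)).
    by apply: eq_integrable (integrableZl measurableT q Ig) => // x _.
  split; last by rewrite RintegralD// !RintegralZl.
  by apply: eq_integrable (integrableD measurableT Ipf Iqg) => // x _.
have [I1 E1] := cr _ _ (Re a) (- Im a) (L2_intg_Re u v) (L2_intg_Im u v).
have [I2 E2] := cr _ _ (Re a) (Im a) (L2_intg_Im u v) (L2_intg_Re u v).
have [J1 F1] := cr _ _ 1 1 I1 (L2_intg_Re w v).
have [J2 F2] := cr _ _ 1 1 I2 (L2_intg_Im w v).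
have aR : {ae mu, forall x, Re ((a *: u + w : L2) x * (v x)^*) =
    1 * (Re a * Re (u x * (v x)^*) + (- Im a) * Im (u x * (v x)^*)) +
    1 * Re (w x * (v x)^*)}.
  apply: filterS (L2_linE a u w) => x ->.
  by case: a (u x) (w x) (v x) {cr I1 E1 I2 E2 J1 F1 J2 F2}
    => [a b] [p q] [r s] [t y] /=; ring.
have aI : {ae mu, forall x, Im ((a *: u + w : L2) x * (v x)^*) =
    1 * (Re a * Im (u x * (v x)^*) + Im a * Re (u x * (v x)^*)) +
    1 * Im (w x * (v x)^*)}.
  apply: filterS (L2_linE a u w) => x ->.
  by case: a (u x) (w x) (v x) {cr I1 E1 I2 E2 J1 F1 J2 F2 aR}
    => [a b] [p q] [r s] [t y] /=; ring.
rewrite {1}/L2_inner (ae_eq_Rintegral _ _ aR)//; last exact: L2_intg_Re.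
rewrite (ae_eq_Rintegral _ _ aI)//; last exact: L2_intg_Im.
rewrite F1 F2 E1 E2 /L2_inner.
case: a {cr I1 E1 I2 E2 J1 F1 J2 F2 aR aI} => a b /=.
by congr (_ +i* _) => /=; ring.
Qed.

Fact L2_inner_bilinear : bilinear_for *%R (Num.conj \; *%R) L2_inner.
Proof.
split=> [v a x y|u a x y] /=; first exact: L2_inner_linear.
rewrite L2_inner_herm L2_inner_linear/= expr0 mul1r rmorphD rmorphM/=.
by congr (_ * _ + _); rewrite [RHS]L2_inner_herm expr0 mul1r.
Qed.

Fact L2_inner_gt0 (u : L2) : u != 0 -> 0 < L2_inner u u.
Proof.
move=> u0.
have -> : L2_inner u u = (fine (\int[mu]_x (sqnorm (u x))%:E))%:C.
  rewrite /L2_inner /real_complex_def; congr (_ +i* _).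
    rewrite /Rintegral; congr fine; apply: eq_integral => x _.
    by congr EFin; rewrite /sqnorm; case: (u x) => a b /=; ring.
  rewrite /Rintegral integral0_eq// => x _; congr EFin.
  by case: (u x) => a b /=; ring.
rewrite ltcR lt_neqAle eq_sym fine_ge0 ?andbT; last first.
  by apply: integral_ge0 => x _; rewrite lee_fin sqnorm_ge0.
apply: contra u0 => /eqP I0.
have {}I0 : (\int[mu]_x (sqnorm (u x))%:E = 0)%E.
  rewrite -[LHS]fineK ?I0// ge0_fin_numE ?L2_fin//.
  by apply: integral_ge0 => x _; rewrite lee_fin sqnorm_ge0.
apply/eqP; rewrite -[u]reprK -L2_pi0; apply/L2_piP.
have : ae_eq mu setT (EFin \o (fun x => sqnorm (u x))) (cst 0%E).
  apply/ae_eq_integral_abs => //.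
    by apply/measurable_EFinP/measurable_sqnorm; exact: L2_measurable.
  rewrite -[RHS]I0; apply: eq_integral => x _ /=.
  by rewrite ger0_norm// sqnorm_ge0.
apply: filterS => x /(_ I) [].
rewrite -[X in _ -> X]/(u x = 0) /sqnorm.
case: (u x) => a b /= /eqP; rewrite paddr_eq0 ?sqr_ge0// !sqrf_eq0.
by case/andP => /eqP -> /eqP ->.
Qed.

HB.instance Definition _ :=
  @bilinear_isBilinear.Build R[i] L2 L2 R[i] *%R (Num.conj \; *%R) L2_inner
    L2_inner_bilinear.
HB.instance Definition _ :=
  @isHermitianSesquilinear.Build R[i] L2 false Num.conj L2_inner L2_inner_herm.
HB.instance Definition _ := @isDotProduct.Build R[i] L2 L2_inner L2_inner_gt0.
HB.instance Definition _ := @isInnerProduct.Build R L2 L2_inner.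

End L2_space.

(** An operator from [E] to [F] is represented by its graph, a set of pairs;
    inclusion and equality of operators are those of the graphs. *)

Section operators.
Context {R : realType}.
Implicit Types E F G : innerProductType R.

Definition hnorm {E} (x : E) : R := Num.sqrt (Re (inner x x)).

Definition hclosure {E} (D : set E) : set E :=
  [set x | forall e : R, 0 < e -> exists2 y, D y & hnorm (x - y) < e].

Definition hdense {E} (D : set E) := hclosure D = setT.

Definition orthocomp {E} (D : set E) : set E :=
  [set x | forall y, D y -> inner x y = 0].

Definition op_dom {E F} (T : set (E * F)) : set E :=
  [set x | exists y, T (x, y)].

Definition op_ker {E F} (T : set (E * F)) : set E := [set x | T (x, 0)].

Definition op_comp {E F G} (S : set (F * G)) (T : set (E * F)) : set (E * G) :=
  [set p | exists2 y, T (p.1, y) & S (y, p.2)].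

(** The sum has domain [op_dom S `&` op_dom T], and [op_scale a T] has domain
    [op_dom T] even for [a = 0]. *)
Definition op_add {E F} (S T : set (E * F)) : set (E * F) :=
  [set p | exists y z, [/\ S (p.1, y), T (p.1, z) & p.2 = y + z]].

Definition op_scale {E F} (a : R) (T : set (E * F)) : set (E * F) :=
  [set p | exists2 y, T (p.1, y) & p.2 = a%:C *: y].

Definition adjoint {E F} (T : set (E * F)) : set (F * E) :=
  [set p | forall x y, T (x, y) -> inner y p.1 = inner x p.2].

Definition linear_op {E F} (T : set (E * F)) :=
  [/\ T 0, (forall a p q, T p -> T q -> T (a *: p + q)) &
      (forall y, T (0, y) -> y = 0)].

Definition bounded_op {E F} (T : set (E * F)) :=
  exists c : R, forall x y, T (x, y) -> hnorm y <= c * hnorm x.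

Definition selfadjoint {E} (A : set (E * E)) :=
  hdense (op_dom A) /\ adjoint A = A.

Definition positive_op {E} (A : set (E * E)) :=
  forall x y, A (x, y) -> 0 <= inner y x.

(** [A] is the positive self-adjoint square root of [T^* T]. *)
Definition is_modulus {E F} (T : set (E * F)) (A : set (E * E)) :=
  [/\ selfadjoint A, positive_op A & op_comp A A = op_comp (adjoint T) T].

Definition modulus {E F} (T : set (E * F)) : set (E * E) :=
  xget set0 (is_modulus T).

Definition partial_isometry {E F} (U : set (E * F)) :=
  [/\ linear_op U, op_dom U = setT, bounded_op U &
      forall x y, orthocomp (op_ker U) x -> U (x, y) -> hnorm y = hnorm x].

(** [U] is the partial isometry of the polar decomposition [T = U |T|]. *)
Definition is_phase {E F} (T : set (E * F)) (U : set (E * F)) :=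
  [/\ partial_isometry U, op_ker U = op_ker T & T = op_comp U (modulus T)].

Definition phase {E F} (T : set (E * F)) : set (E * F) :=
  xget set0 (is_phase T).

(** A pair of operators, identified with the column operator, whose domain is
    [op_dom T1 `&` op_dom T2]. *)
Definition column {E F} (T1 T2 : set (E * F)) : set (E * (F * F)) :=
  [set p | T1 (p.1, p.2.1) /\ T2 (p.1, p.2.2)].

Definition component1 {E F} (T : set (E * (F * F))) : set (E * F) :=
  [set p | exists z, T (p.1, (p.2, z))].

Definition component2 {E F} (T : set (E * (F * F))) : set (E * F) :=
  [set p | exists z, T (p.1, (z, p.2))].

Definition mean_component {E} (lambda : R) (A U : set (E * E)) : set (E * E) :=
  op_add (op_scale lambda (op_comp U A)) (op_scale (1 - lambda) (op_comp A U)).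

Definition spherical_mean_transform {E} (lambda : R) (T : set (E * (E * E))) :
    set (E * (E * E)) :=
  column (mean_component lambda (modulus T) (component1 (phase T)))
         (mean_component lambda (modulus T) (component2 (phase T))).

End operators.

Section weighted_measure.
Context {R : realType} {d : measure_display} {X : measurableType d}.
Variables (mu : {measure set X -> \bar R}) (w : X -> R[i]).
Hypothesis mw : cmeasurable w.
Local Open Scope ereal_scope.

(** The measure [|w|^2 dmu]; the measurability proof is an argument so that the
    measure instance can be found. *)
Definition wmeasure (_ : cmeasurable w) (A : set X) : \bar R :=
  \int[mu]_(x in A) (sqnorm (w x))%:E.

Let wmeasure0 : wmeasure mw set0 = 0.
Proof. by rewrite /wmeasure integral_set0. Qed.

Let wmeasure_ge0 A : 0 <= wmeasure mw A.
Proof. by apply: integral_ge0 => x _; rewrite lee_fin sqnorm_ge0. Qed.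

Let wmeasure_sigma_additive : semi_sigma_additive (wmeasure mw).
Proof.
apply: semi_sigma_additive_nng_induced.
  by apply/measurable_EFinP/measurable_sqnorm.
by move=> x; rewrite lee_fin sqnorm_ge0.
Qed.

HB.instance Definition _ := isMeasure.Build _ _ _ (wmeasure mw)
  wmeasure0 wmeasure_ge0 wmeasure_sigma_additive.

End weighted_measure.

Section weighted_composition.
Context {R : realType} {d : measure_display} {X : measurableType d}.
Variable mu : {measure set X -> \bar R}.
Implicit Types (phi : X -> X) (w : X -> R[i]) (h H G : X -> \bar R).
Local Open Scope ereal_scope.

(** The definition does not depend on the representatives as soon as
    [mu_w \o phi^-1 << mu]. *)
Definition wcomp phi w : set (L2 mu * L2 mu) :=
  [set p : L2 mu * L2 mu | {ae mu, forall x, p.2 x = (w x * p.1 (phi x))%R}].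

(** [h] is a version of the Radon-Nikodym derivative of [nu] with respect to
    [mu]. *)
Definition is_RN_derivative (nu : set X -> \bar R) h :=
  [/\ measurable_fun setT h, forall x, 0 <= h x &
      forall D, measurable D -> nu D = \int[mu]_(x in D) h x].

(** [f] is a version of the conditional expectation of [H] with respect to
    [nu] and the sigma-algebra [phi^-1(A)]. *)
Definition is_cond_expectation (nu : {measure set X -> \bar R}) phi H
    (f : X -> \bar R) :=
  [/\ measurable_fun [set: g_sigma_algebra_preimageType phi] f,
      forall x, 0 <= f x &
      forall D, measurable D ->
        \int[nu]_(x in phi @^-1` D) H x = \int[nu]_(x in phi @^-1` D) f x].

(** [G] is a version of [f \o phi^-1], where [h] is the Radon-Nikodym
    derivative of [nu \o phi^-1]. *)
Definition is_pullback (nu : {measure set X -> \bar R}) phi h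
    (f G : X -> \bar R) :=
  [/\ measurable_fun setT G, forall x, 0 <= G x,
      {ae mu, forall x, h x = 0 -> G x = 0} &
      {ae nu, forall x, G (phi x) = f x}].

(** The function [(E(H) \o phi^-1) h \1_{H > 0} / H], where [G] is a version of
    [E(H) \o phi^-1]. *)
Definition sfE H h G (x : X) : \bar R :=
  if H x == 0 then 0 else G x * (h x / H x).

(** The function [\1_{w != 0} (H / (H \o phi))^(1/2)]; [fine] and the
    conventions [0^-1 = +oo] and [(+oo)^-1 = 0] only matter on a null set. *)
Definition eta H phi w (x : X) : R :=
  if w x == 0%R then 0%R else Num.sqrt (fine (H x / H (phi x))).

Definition mean_weight (lambda : R) H phi w (x : X) : R[i] :=
  ((eta H phi w x + lambda * (1 - eta H phi w x))%R%:C * w x)%R.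

(** The space [L^2(rho dmu)]; note that [0 * +oo = 0] in [\bar R]. *)
Definition L2_weighted (rho : X -> \bar R) : set (L2 mu) :=
  [set f : L2 mu | \int[mu]_x ((sqnorm (f x))%:E * rho x) < +oo].

(** The subspace [\1_S L^2(mu)] of [L^2(mu)]. *)
Definition L2_on (S : set X) : set (L2 mu) :=
  [set f : L2 mu | exists g : L2 mu, {ae mu, forall x, f x = (\1_S x * g x)%R}].

End weighted_composition.
Arguments wcomp {R d X} mu phi w.
Arguments is_RN_derivative {R d X} mu nu h.
Arguments is_pullback {R d X} mu nu phi h f G.
Arguments L2_weighted {R d X} mu rho.
Arguments L2_on {R d X} mu S.

(* Main.v *)
Require Import Defs.
From mathcomp Require Import all_boot all_order all_algebra.
From mathcomp Require Import generic_quotient.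
From mathcomp Require Import all_classical all_reals all_analysis.
From mathcomp Require Import measurable_realfun.
From mathcomp Require Import complex.
From mathcomp Require Import ring lra.

(** Write [H = h1 + h2] and [a = sqrt H]; density of the two domains makes [H]
    finite almost everywhere.  By the change of variables along [phi_i], the
    squared norm of [w_i (f o phi_i)] is the integral of [|f|^2 h_i].  Hence the
    column operator [T] has the same domain as the operator [A] of
    multiplication by [a], and [|Tf| = |Af|] there; polarization gives
    [T^* T = A^2] ([adjoint_comp_square]).

    To conclude [|T| = A], one needs that [A] is the only positive self-adjoint
    [B] with [B^2 = A^2] ([mulop_root_unique]).  The argument uses no spectral
    theorem for [B].  If [f] lives on a slab [s <= a < s + e], then [B^2] nearly
    acts on [f] as the scalar [s^2]; factoring [B^2 - s^2 = (B + s)(B - s)], where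
    positivity bounds [B + s] below by [s], shows that [B] and [A] both nearly
    act on [f] as the scalar [s], so [|(B - A)f|^2 <= c e^2 |f|^2].  Cutting
    the slab into two halves produces orthogonal pieces and therefore the same
    estimate with [c / 2]; iterating, [Bf = Af].  This settles the functions on
    which [a] is bounded, they form a core of [A] ([mulop_adjoint_core]), and
    self-adjointness of both operators does the rest.

    The phase of [T] has the components [U_i f = (w_i / (a o phi_i)) (f o phi_i)]:
    the change of variables shows that they form a partial isometry with the
    kernel of [T] and that [T = U A], and a phase is determined by its values on
    [ker T] and on the range of [|T|], whose sum is dense ([phase_unique]).

    Consequently the i-th component of the mean transform multiplies [f o phi_i]
    by [lambda w_i + (1 - lambda) (a / (a o phi_i)) w_i], which is the mean weight.
    Its domain is governed by the integrals of [|f|^2 H] for [U_i A], and of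
    [|a U_i f|^2] for [A U_i]; the defining properties of the conditional
    expectation turn the latter into the integral of [|f|^2] against [sfE H h_i G_i]
    ([integral_modulus_phase], [mean_componentP]).  So the domain of the
    transform is a weighted L2 space; its closure and orthogonal complement are
    those of any weighted L2 space, supported where the weight is finite,
    respectively infinite, and the weight is infinite exactly where [G1 + G2] is
    ([sfE_lty]).  When [0 < lambda < 1], the mean weight dominates a positive
    multiple of each of its two summands, which are both nonnegative multiples of
    [w_i], so the weighted composition operators on the right have no larger
    domain ([mean_weight_dom]). *)

Set Implicit Arguments.
Unset Strict Implicit.
Unset Printing Implicit Defensive.
Import Order.TTheory GRing.Theory Num.Theory.
Import numFieldNormedType.Exports.

Local Open Scope classical_set_scope.
Local Open Scope ring_scope.
Local Open Scope complex_scope.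
Local Open Scope quotient_scope.

Local Notation Re := complex.Re.
Local Notation Im := complex.Im.

(** * Inner product spaces and unbounded operators *)

Section inner_product.
Context {R : realType} {E : innerProductType R}.
Implicit Types (x y z : E) (a : R[i]) (D : set E).

Lemma innerDl x y z : inner (x + y) z = inner x z + inner y z.
Proof. exact: linearDl. Qed.

Lemma innerDr x y z : inner x (y + z) = inner x y + inner x z.
Proof. exact: linearDr. Qed.

Lemma innerBl x y z : inner (x - y) z = inner x z - inner y z.
Proof. exact: linearBl. Qed.

Lemma innerBr x y z : inner x (y - z) = inner x y - inner x z.
Proof. exact: linearBr. Qed.

Lemma innerZl a x y : inner (a *: x) y = a * inner x y.
Proof. exact: linearZl_LR. Qed.

Lemma innerZr a x y : inner x (a *: y) = a^* * inner x y.
Proof. exact: linearZr. Qed.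

Lemma innerC x y : inner x y = (inner y x)^*.
Proof. by rewrite [LHS](hermitian_subproof (s := inner)) expr0 mul1r. Qed.

(** The squared norm; unlike [hnorm] it is polynomial in the inner product and
    is literally an integral on L2. *)
Definition hsq x : R := Re (inner x x).

Lemma innerxx x : inner x x = (hsq x)%:C.
Proof.
have : 0 <= inner x x by exact: dnorm_ge0.
by rewrite /hsq; case: (inner x x) => p q /=; rewrite lecE /= => /andP[/eqP -> _].
Qed.

Lemma hsq_ge0 x : 0 <= hsq x.
Proof. by have : 0 <= inner x x by [exact: dnorm_ge0]; rewrite innerxx lecR. Qed.

Lemma hsq_eq0 x : hsq x = 0 -> x = 0.
Proof.
move=> x0; apply/eqP; apply: contraT.
by rewrite -(dnorm_gt0 inner) innerxx x0 ltxx.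
Qed.

Lemma hsqD x y : hsq (x + y) = hsq x + hsq y + 2 * Re (inner x y).
Proof.
rewrite /hsq innerDl !innerDr [inner y x]innerC.
by case: (inner x x) (inner x y) (inner y y) => a b [c e] [p q] /=; ring.
Qed.

Lemma hsqZ a x : hsq (a *: x) = sqnorm a * hsq x.
Proof.
rewrite /hsq innerZl innerZr innerxx /sqnorm.
by case: a => p q /=; ring.
Qed.

Lemma hsqN x : hsq (- x) = hsq x.
Proof. by rewrite -scaleN1r hsqZ /sqnorm /=; ring. Qed.

Lemma hsqB x y : hsq (x - y) = hsq x + hsq y - 2 * Re (inner x y).
Proof. by rewrite hsqD hsqN -scaleN1r innerZr; case: (inner x y) => a b /=; ring. Qed.

Lemma hsqD_le x y : hsq (x + y) <= 2 * hsq x + 2 * hsq y.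
Proof. by have := hsq_ge0 (x - y); rewrite hsqB hsqD; lra. Qed.

Lemma hsqB_le x y : hsq (x - y) <= 2 * hsq x + 2 * hsq y.
Proof. by rewrite -[hsq y]hsqN; exact: hsqD_le. Qed.

Lemma hnorm_sqr x : hnorm x ^+ 2 = hsq x.
Proof. by rewrite sqr_sqrtr ?hsq_ge0. Qed.

Lemma hclosureP D x :
  hclosure D x <-> forall e : R, 0 < e -> exists2 y, D y & hsq (x - y) < e.
Proof.
split=> [H e e0|H e e0].
  have [|y Dy xy] := H (Num.sqrt e); first by rewrite sqrtr_gt0.
  by exists y => //; move: xy; rewrite ltr_sqrt.
have [|y Dy xy] := H (e ^+ 2); first by rewrite exprn_gt0.
by exists y => //; rewrite -(ger0_norm (ltW e0)) -sqrtr_sqr ltr_sqrt ?exprn_gt0.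
Qed.

(** An element [y] of [D] orthogonal to [x] satisfies
    [|x - y|^2 = |x|^2 + |y|^2 >= |x|^2]. *)
Lemma dense_orthocomp D x : hdense D -> orthocomp D x -> x = 0.
Proof.
move=> dD oD; apply: hsq_eq0; apply/eqP; rewrite eq_le hsq_ge0 andbT leNgt.
apply/negP => x0; have : hclosure D x by rewrite dD.
move=> /hclosureP/(_ _ x0)[y Dy]; rewrite hsqB oD//= mulr0 subr0.
by rewrite -{2}[hsq x]addr0 ltrD2l ltNge hsq_ge0.
Qed.

End inner_product.

Section polarization.
Context {R : realType} {E F : innerProductType R}.

(** Comparing the hypothesis at [a = 0], [1] and [-1] gives the equality of the
    squared norms and of the real parts; [a = i] then gives the imaginary
    parts. *)
Lemma polarization (x y : E) (u v : F) :
  (forall a : R[i], hsq (a *: x + y) = hsq (a *: u + v)) ->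
  inner x y = inner u v.
Proof.
move=> xyuv.
have e : forall a, sqnorm a * hsq x + hsq y + 2 * Re (a * inner x y) =
                   sqnorm a * hsq u + hsq v + 2 * Re (a * inner u v).
  by move=> a; have := xyuv a; rewrite !hsqD !hsqZ !innerZl.
move: (e 0) (e 1) (e (-1)) (e 'i%C); rewrite /sqnorm.
move: (inner x y) (inner u v) (hsq x) (hsq y) (hsq u) (hsq v) => [a b] [p q] X Y U V /=.
by move=> e0 e1 e2 e3; congr (_ +i* _); lra.
Qed.

End polarization.

Section linear_operators.
Context {R : realType} {E F : innerProductType R}.
Implicit Types T : set (E * F).

Lemma linear_opB T p q : linear_op T -> T p -> T q -> T (p - q).
Proof.
case=> _ Tl _ Tp Tq; rewrite addrC -scaleN1r; exact: Tl.
Qed.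

Lemma linear_opD T p q : linear_op T -> T p -> T q -> T (p + q).
Proof. by case=> _ Tl _ Tp Tq; rewrite -[p]scale1r; exact: Tl. Qed.

Lemma linear_opZ T a p : linear_op T -> T p -> T (a *: p).
Proof. by case=> T0 Tl _ Tp; rewrite -[_ *: _]addr0; exact: Tl. Qed.

Lemma linear_op_fun T x y z : linear_op T -> T (x, y) -> T (x, z) -> y = z.
Proof.
move=> lT Txy Txz; have := linear_opB lT Txy Txz; case: lT => _ _ T0.
by rewrite -[X in T X]/(x - x, y - z) subrr => /T0/eqP; rewrite subr_eq0 => /eqP.
Qed.

Lemma bounded_op_hsq T : bounded_op T ->
  exists2 c : R, 0 < c & forall x y, T (x, y) -> hsq y <= c * hsq x.
Proof.
case=> c cT; exists (c ^+ 2 + 1); first by rewrite ltr_wpDl ?sqr_ge0.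
move=> x y /cT cxy; rewrite -!hnorm_sqr.
apply: (@le_trans _ _ ((c * hnorm x) ^+ 2)).
  by rewrite lerXn2r ?nnegrE ?sqrtr_ge0// (le_trans _ cxy) ?sqrtr_ge0.
by rewrite exprMn ler_wpM2r ?sqr_ge0// lerDl.
Qed.

Lemma bounded_op_eq U V (D : set E) :
  linear_op U -> linear_op V -> op_dom U = setT -> op_dom V = setT ->
  bounded_op U -> bounded_op V -> hdense D ->
  (forall x y, D x -> U (x, y) -> V (x, y)) -> U = V :> set (E * F).
Proof.
move=> lU lV dU dV /bounded_op_hsq[c c0 bU] /bounded_op_hsq[c' c'0 bV] dD UV.
suff key x y z : U (x, y) -> V (x, z) -> y = z.
  apply/seteqP; split=> -[x y] xy.
    have [z xz] : op_dom V x by rewrite dV.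
    by rewrite (key _ _ _ xy xz).
  have [z xz] : op_dom U x by rewrite dU.
  by rewrite -(key _ _ _ xz xy).
move=> Uxy Vxz; apply/eqP; rewrite -subr_eq0; apply/eqP/hsq_eq0/eqP.
rewrite eq_le hsq_ge0 andbT leNgt; apply/negP => d0.
pose k := 2 * c + 2 * c'; have k0 : 0 < k by rewrite addr_gt0 ?mulr_gt0.
have : hclosure D x by rewrite dD.
move=> /hclosureP/(_ (hsq (y - z) / k))[|x' Dx']; first exact: divr_gt0.
rewrite ltr_pdivlMr// ltNge => /negP; apply.
have [y' Uy'] : op_dom U x' by rewrite dU.
have Vy' := UV _ _ Dx' Uy'.
have -> : y - z = (y - y') - (z - y') by rewrite opprB addrA subrK.
apply: le_trans (hsqB_le _ _) _.
have h1 : hsq (y - y') <= c * hsq (x - x') by apply: bU; exact: linear_opB lU Uxy Uy'.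
have h2 : hsq (z - y') <= c' * hsq (x - x') by apply: bV; exact: linear_opB lV Vxz Vy'.
by rewrite /k mulrDr; move: h1 h2; move: (hsq _) (hsq _) (hsq _) => p q r; lra.
Qed.

End linear_operators.

Section selfadjoint_operators.
Context {R : realType} {E F : innerProductType R}.

Lemma selfadjoint_inner (A : set (E * E)) x x' y y' :
  selfadjoint A -> A (x, x') -> A (y, y') -> inner x' y = inner x y'.
Proof. by case=> _ AA Axx'; rewrite -{1}AA => /(_ _ _ Axx'). Qed.

Lemma selfadjointP (A : set (E * E)) y y' : selfadjoint A ->
  (forall x x', A (x, x') -> inner x' y = inner x y') -> A (y, y').
Proof. by case=> _ AA H; rewrite -AA => x x'; exact: H. Qed.

(** An adjoint graph is always a subspace; it is single-valued because the
    domain is dense. *)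
Lemma selfadjoint_linear (A : set (E * E)) : selfadjoint A -> linear_op A.
Proof.
move=> sA; split.
- by apply: selfadjointP => // x x' _; rewrite !linear0r.
- move=> a [p p'] [q q'] Ap Aq; apply: selfadjointP => // x x' Ax.
  by rewrite !innerDr !innerZr (selfadjoint_inner sA Ax Ap) (selfadjoint_inner sA Ax Aq).
- move=> y A0y; have [dA _] := sA; apply: (dense_orthocomp dA) => x [x' Ax].
  by rewrite (selfadjoint_inner sA A0y Ax) linear0l.
Qed.

(** Polarization turns [|Tx| = |Ax|] into [<Tx, Ty> = <Ax, Ay>], so that
    [T^* T = A^* A = A^2]. *)
Lemma adjoint_comp_square (A : set (E * E)) (T : set (E * F)) :
  selfadjoint A -> linear_op T -> op_dom A = op_dom T ->
  (forall x y z, A (x, y) -> T (x, z) -> hsq y = hsq z) ->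
  op_comp A A = op_comp (adjoint T) T.
Proof.
move=> sA lT dAT nAT; have lA := selfadjoint_linear sA.
have pol x x' z y y' w : A (x, x') -> T (x, z) -> A (y, y') -> T (y, w) ->
    inner x' y' = inner z w.
  move=> Ax Tx Ay Ty; apply: polarization => a; apply: (nAT (a *: x + y)).
    by case: lA => _ /(_ a _ _ Ax Ay).
  by case: lT => _ /(_ a _ _ Tx Ty).
apply/seteqP; split=> -[f g] /= [k].
  move=> Afk Akg; have [z Tfz] : op_dom T f by rewrite -dAT; exists k.
  exists z => // x y Txy; have [x' Axx'] : op_dom A x by rewrite dAT; exists y.
  by rewrite -(pol _ _ _ _ _ _ Axx' Txy Afk Tfz) (selfadjoint_inner sA Axx' Akg).
move=> Tfk aTk; have [z Afz] : op_dom A f by rewrite dAT; exists k.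
exists z => //; apply: selfadjointP => // x x' Axx'.
have [y Txy] : op_dom T x by rewrite -dAT; exists x'.
by rewrite (pol _ _ _ _ _ _ Axx' Txy Afz Tfk) (aTk _ _ Txy).
Qed.

End selfadjoint_operators.

Section pairs.
Context {R : realType} {E F : innerProductType R}.

Lemma hsq_pair (u : E * F) : hsq u = hsq u.1 + hsq u.2.
Proof.
rewrite {1}/hsq (_ : inner u u = inner u.1 u.1 + inner u.2 u.2)//.
by rewrite !innerxx.
Qed.

Lemma column_linear (S T : set (E * F)) :
  linear_op S -> linear_op T -> linear_op (column S T).
Proof.
move=> [S0 Sl Sf] [T0 Tl Tf]; split => //.
- by move=> a p q [Sp Tp] [Sq Tq]; split; [exact: Sl Sp Sq|exact: Tl Tp Tq].
- by move=> [y z] [/= /Sf -> /Tf ->].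
Qed.

End pairs.

Section polar_decomposition.
Context {R : realType} {E F : innerProductType R}.
Variable T : set (E * F).

Lemma modulus_unique A : is_modulus T A ->
  (forall B, is_modulus T B -> B = A) -> modulus T = A.
Proof. by move=> TA TB; apply: xget_subset1 => // B C /TB -> /TB ->. Qed.

(** Any phase vanishes on the kernel of [T] and sends [|T|g] to [Tg]; being
    bounded, it is determined by these values. *)
Lemma phase_unique U : is_phase T U -> linear_op (modulus T) ->
  hdense [set x | exists f g y, [/\ x = f + y, T (f, 0) & modulus T (g, y)]] ->
  phase T = U.
Proof.
move=> TU lA dD; apply: xget_subset1 => // {U TU} U V.
move=> [[lU dU bU _] kU TU] [[lV dV bV _] kV TV].
apply: (bounded_op_eq lU lV dU dV bU bV dD) => x z [f [g [y [-> Tf0 Agy]]]] Uz.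
have Uf0 : U (f, 0) by rewrite -[U _]/(op_ker U f) kU.
have Vf0 : V (f, 0) by rewrite -[V _]/(op_ker V f) kV.
have [t Uyt] : op_dom U y by rewrite dU.
have : T (g, t) by rewrite TU; exists y.
rewrite TV => -[y' /= Agy' Vy't].
rewrite (linear_op_fun lA Agy' Agy) in Vy't.
have Ut : U (f + y, 0 + t) by exact: (linear_opD lU Uf0 Uyt).
by rewrite (linear_op_fun lU Uz Ut); exact: (linear_opD lV Vf0 Vy't).
Qed.

End polar_decomposition.

(** * The space L2 *)

Section sqnorm.
Context {R : realType}.
Implicit Types z : R[i].

Lemma sqnormM z1 z2 : sqnorm (z1 * z2) = sqnorm z1 * sqnorm z2.
Proof. by case: z1 z2 => [a b] [c e]; rewrite /sqnorm /=; ring. Qed.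

Lemma sqnormR (r : R) : sqnorm r%:C = r ^+ 2.
Proof. by rewrite /sqnorm /= expr0n addr0. Qed.

Lemma sqnorm0 : sqnorm (0 : R[i]) = 0.
Proof. by rewrite /sqnorm /= expr0n addr0. Qed.

Lemma sqnorm_eq0 z : (sqnorm z == 0) = (z == 0).
Proof.
by case: z => a b; rewrite /sqnorm /= paddr_eq0 ?sqr_ge0// !sqrf_eq0 eq_complex.
Qed.

Lemma indic_toC T (S : set T) x : \1_S x = (\1_S x : R)%:C :> R[i].
Proof. by rewrite !indicE; case: (x \in S). Qed.

End sqnorm.

Section complex_measurability.
Context {R : realType} {d : measure_display} {X : measurableType d}.
Implicit Types f g : X -> R[i].

Lemma cmeasurableM f g : cmeasurable f -> cmeasurable g ->
  cmeasurable (fun x => f x * g x).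
Proof.
move=> [fr fi] [gr gi]; split.
  rewrite [X in measurable_fun _ X](_ : _ =
    fun x => Re (f x) * Re (g x) - Im (f x) * Im (g x)).
    by apply: measurable_funB; exact: measurable_funM.
  by apply/funext => x; case: (f x) (g x) => [a b] [p q].
rewrite [X in measurable_fun _ X](_ : _ =
  fun x => Re (f x) * Im (g x) + Im (f x) * Re (g x)).
  by apply: measurable_funD; exact: measurable_funM.
by apply/funext => x; case: (f x) (g x) => [a b] [p q].
Qed.

Lemma cmeasurable_comp f (phi : X -> X) : measurable_fun setT phi ->
  cmeasurable f -> cmeasurable (fun x => f (phi x)).
Proof. by move=> mphi [fr fi]; split; [move: fr|move: fi] => mf; exact: measurableT_comp mf mphi. Qed.

Lemma cmeasurable_real (r : X -> R) : measurable_fun setT r ->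
  cmeasurable (fun x => (r x)%:C).
Proof. by move=> mr; split => //=; exact: measurable_cst. Qed.

Lemma cmeasurable_indic (S : set X) : measurable S ->
  cmeasurable (fun x => \1_S x : R[i]).
Proof.
move=> mS; have -> : (fun x => \1_S x : R[i]) = (fun x => (\1_S x : R)%:C).
  by apply/funext => x; exact: indic_toC.
by apply: cmeasurable_real; exact: measurable_indic.
Qed.

Lemma emeasurable_sqnorm f : cmeasurable f ->
  measurable_fun setT (fun x => (sqnorm (f x))%:E).
Proof. by move=> mf; apply/measurable_EFinP; exact: measurable_sqnorm. Qed.

End complex_measurability.

Section L2_theory.
Context {R : realType} {d : measure_display} {X : measurableType d}.
Variable mu : {measure set X -> \bar R}.
Implicit Types (u v : L2 mu) (f : X -> R[i]) (S : set X).

Lemma L2_exists f : cmeasurable f -> (\int[mu]_x (sqnorm (f x))%:E < +oo)%E ->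
  exists u, {ae mu, forall x, u x = f x}.
Proof.
move=> mf If; have pf : f \in L2fun_pred mu by rewrite inE.
by exists (\pi_(L2 mu) (MkL2fun pf)); exact: L2_reprP.
Qed.

Lemma hsqE u : (hsq u)%:E = (\int[mu]_x (sqnorm (u x))%:E)%E.
Proof.
rewrite /hsq -[inner u u]/(L2_inner u u) /L2_inner /=.
rewrite [X in X%:E](_ : _ = fine (\int[mu]_x (sqnorm (u x))%:E)%E).
  rewrite fineK// ge0_fin_numE ?L2_fin//.
  by apply: integral_ge0 => x _; rewrite lee_fin sqnorm_ge0.
rewrite /Rintegral; congr fine; apply: eq_integral => x _.
by congr EFin; rewrite /sqnorm; case: (u x) => a b /=; ring.
Qed.

Lemma hsq_aeE u f : cmeasurable f -> {ae mu, forall x, u x = f x} ->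
  (hsq u)%:E = (\int[mu]_x (sqnorm (f x))%:E)%E.
Proof.
move=> mf uf; rewrite hsqE; apply: ge0_ae_eq_integral => //.
- exact/emeasurable_sqnorm/L2_measurable.
- exact: emeasurable_sqnorm.
- by move=> x _; rewrite lee_fin sqnorm_ge0.
- by move=> x _; rewrite lee_fin sqnorm_ge0.
- by apply: filterS uf => x -> _.
Qed.

Lemma inner_ae u v u' v' :
  {ae mu, forall x, u x * (v x)^* = u' x * (v' x)^*} -> inner u v = inner u' v'.
Proof.
move=> uv; rewrite -[LHS]/(L2_inner u v) -[RHS]/(L2_inner u' v') /L2_inner.
congr (_ +i* _).
  by apply: (ae_eq_Rintegral (L2_intg_Re _ _) (L2_intg_Re _ _)); apply: filterS uv => x ->.
by apply: (ae_eq_Rintegral (L2_intg_Im _ _) (L2_intg_Im _ _)); apply: filterS uv => x ->.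
Qed.

Lemma L2_0E : {ae mu, forall x, (0 : L2 mu) x = 0}.
Proof. by rewrite -L2_pi0; apply: L2_reprP. Qed.

Lemma inner_ae0 u v : {ae mu, forall x, u x * (v x)^* = 0} -> inner u v = 0.
Proof.
move=> uv; rewrite (@inner_ae _ _ 0 v) ?linear0l//.
by move: uv L2_0E; apply: filterS2 => x -> ->; rewrite mul0r.
Qed.

Lemma L2_subE u v : {ae mu, forall x, (u - v : L2 mu) x = u x - v x}.
Proof.
have := L2_linE (-1) v u; rewrite scaleN1r addrC.
by apply: filterS => x ->; rewrite mulN1r addrC.
Qed.

Lemma L2_bound f u (c : R) : 0 <= c -> cmeasurable f ->
  {ae mu, forall x, sqnorm (f x) <= c * sqnorm (u x)} ->
  (\int[mu]_x (sqnorm (f x))%:E <= (c * hsq u)%:E)%E.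
Proof.
move=> c0 mf fu; have mu' := emeasurable_sqnorm (L2_measurable u).
rewrite EFinM hsqE -ge0_integralZl//; last by move=> x _; rewrite lee_fin sqnorm_ge0.
apply: ae_ge0_le_integral => //.
- by move=> x _; rewrite lee_fin sqnorm_ge0.
- exact: emeasurable_sqnorm.
- by move=> x _; rewrite -EFinM lee_fin mulr_ge0 ?sqnorm_ge0.
- by apply: emeasurable_funM => //.
- by apply: filterS fu => x; rewrite -EFinM lee_fin.
Qed.

Lemma L2_dominated f u (c : R) : 0 <= c -> cmeasurable f ->
  {ae mu, forall x, sqnorm (f x) <= c * sqnorm (u x)} ->
  exists v, {ae mu, forall x, v x = f x}.
Proof.
move=> c0 mf fu; apply: L2_exists => //.
by apply: le_lt_trans (L2_bound c0 mf fu) _; rewrite ltry.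
Qed.

Lemma hsq_le u v (c : R) : 0 <= c ->
  {ae mu, forall x, sqnorm (u x) <= c * sqnorm (v x)} -> hsq u <= c * hsq v.
Proof.
by move=> c0 uv; rewrite -lee_fin hsqE; apply: L2_bound => //; exact: L2_measurable.
Qed.

(** Measurability of [S] is moved into the conclusion so that [cutoff] is defined
    for every set. *)
Lemma cutoff_exists S u : exists v, measurable S ->
  {ae mu, forall x, v x = \1_S x * u x}.
Proof.
have [mS|nS] := pselect (measurable S); last by exists 0.
have [|||v vE] := @L2_dominated (fun x => \1_S x * u x) u 1 => //.
- by apply: cmeasurableM; [exact: cmeasurable_indic|exact: L2_measurable].
- apply: nearW => x; rewrite mul1r sqnormM indic_toC sqnormR indicE.
  by case: (x \in S); rewrite ?expr1n ?mul1r// expr0n mul0r sqnorm_ge0.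
by exists v.
Qed.

(** For measurable [S], the orthogonal projection of [u] onto the functions
    vanishing off [S]. *)
Definition cutoff S u : L2 mu := projT1 (cid (cutoff_exists S u)).

Lemma cutoffE S u : measurable S ->
  {ae mu, forall x, cutoff S u x = \1_S x * u x}.
Proof. by rewrite /cutoff; case: cid. Qed.

Lemma hsq_cutoff S u : measurable S ->
  (hsq (cutoff S u))%:E = (\int[mu]_(x in S) (sqnorm (u x))%:E)%E.
Proof.
move=> mS; rewrite hsqE [RHS]integral_mkcond.
apply: ge0_ae_eq_integral => //.
- exact/emeasurable_sqnorm/L2_measurable.
- apply/(measurable_restrictT _ mS)/measurable_funTS.
  exact/emeasurable_sqnorm/L2_measurable.
- by move=> x _; rewrite lee_fin sqnorm_ge0.
- by move=> x _; apply: erestrict_ge0 => y _; rewrite lee_fin sqnorm_ge0.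
apply: filterS (cutoffE u mS) => x -> _.
rewrite /patch sqnormM indic_toC sqnormR indicE.
by case: (x \in S); rewrite ?expr1n ?mul1r// expr0n mul0r.
Qed.

Lemma hsqB_cutoff S u : measurable S ->
  hsq (u - cutoff S u) = hsq u - hsq (cutoff S u).
Proof.
move=> mS; rewrite hsqB [inner u _](_ : _ = inner (cutoff S u) (cutoff S u)).
  by rewrite innerxx /=; ring.
apply: inner_ae; apply: filterS (cutoffE u mS) => x ->.
by rewrite indicE; case: (x \in S); rewrite ?mul1r// !mul0r rmorph0 mulr0.
Qed.

Definition sublevel (b : X -> R) n := [set x | b x <= n%:R].

Lemma measurable_sublevel (b : X -> R) n : measurable_fun setT b ->
  measurable (sublevel b n).
Proof.
move=> mb; have -> : sublevel b n = [set: X] `&` b @^-1` `]-oo, n%:R].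
  by rewrite setTI; apply/seteqP; split=> x /=; rewrite in_itv.
exact: mb.
Qed.

(** The sublevel sets of a real-valued function increase to the whole space, so
    this is monotone convergence. It is the source of every density statement
    below. *)
Lemma cutoff_approx (b : X -> R) u (e : R) : measurable_fun setT b -> 0 < e ->
  exists n, hsq (u - cutoff (sublevel b n) u) < e.
Proof.
move=> mb e0.
have mS n := measurable_sublevel n mb.
have nd : nondecreasing_seq (sublevel b).
  move=> m n mn; apply/subsetPset => x; rewrite /sublevel /= => /le_trans; apply.
  by rewrite ler_nat.
have mu' n : measurable_fun (sublevel b n) (fun x => (sqnorm (u x))%:E).
  exact/measurable_funTS/emeasurable_sqnorm/L2_measurable.
have u0 n x : sublevel b n x -> (0 <= (sqnorm (u x))%:E)%E by rewrite lee_fin sqnorm_ge0.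
have := @ge0_nondecreasing_set_cvg_integral _ _ _ _ _ mu nd mS mu' u0.
have -> : \bigcup_n sublevel b n = setT.
  apply/seteqP; split=> // x _; exists (Num.truncn (b x)).+1 => //.
  by rewrite /sublevel /= ltW// truncnS_gt.
rewrite -hsqE; under eq_fun do rewrite -hsq_cutoff//.
move=> cv; apply: contrapT => H.
suff : ((hsq u)%:E <= (hsq u - e)%:E)%E by rewrite lee_fin lerDl oppr_ge0 leNgt e0.
rewrite -(cvg_lim _ cv)//; apply: lime_le; first by apply/cvg_ex; exists (hsq u)%:E.
apply: nearW => n; rewrite lee_fin lerBrDr -lerBrDl leNgt; apply/negP => h.
by apply: H; exists n; rewrite hsqB_cutoff.
Qed.

End L2_theory.

(** * Weighted L2 spaces *)

Section weighted_L2.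
Context {R : realType} {d : measure_display} {X : measurableType d}.
Variable mu : {measure set X -> \bar R}.
Implicit Types (u v f : L2 mu) (S : set X).

Lemma L2_onP S f : L2_on mu S f <-> {ae mu, forall x, ~ S x -> f x = 0}.
Proof.
split=> [[g]|f0].
  by apply: filterS => x -> nS; rewrite indicE memNset// mul0r.
exists f; apply: filterS f0 => x f0; rewrite indicE.
by have [xS|xS] := pselect (S x); [rewrite mem_set ?mul1r|rewrite f0 ?mulr0].
Qed.

Lemma L2_on_ae S S' : {ae mu, forall x, S x <-> S' x} -> L2_on mu S = L2_on mu S'.
Proof.
move=> SS; apply/seteqP; split=> f /L2_onP f0; apply/L2_onP.
  by move: SS f0; apply: filterS2 => x SS f0 nS; apply: f0; tauto.
by move: SS f0; apply: filterS2 => x SS f0 nS; apply: f0; tauto.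
Qed.

Lemma cutoff_eq0 S u : measurable S -> cutoff S u = 0 ->
  {ae mu, forall x, S x -> u x = 0}.
Proof.
move=> mS r0; have := cutoffE u mS; rewrite r0; move: (L2_0E mu).
by apply: filterS2 => x -> + Sx; rewrite indicE mem_set// mul1r.
Qed.

Variable rho : X -> \bar R.
Hypotheses (mrho : measurable_fun setT rho) (rho0 : forall x, (0 <= rho x)%E).

(** Where [rho] is infinite, [fine] gives it the junk value [0], so these sets
    contain [rho = +oo]; they are only used on functions vanishing there. *)
Let level n := sublevel (fine \o rho) n.

Let mfrho : measurable_fun setT (fine \o rho).
Proof. by apply: measurableT_comp => //; exact: measurable_fine. Qed.

Let mlevel n : measurable (level n).
Proof. exact: measurable_sublevel. Qed.

Let minfty : measurable [set x | rho x = +oo%E].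
Proof.
by rewrite -[X in measurable X]setTI; exact: (mrho measurableT (emeasurable_set1 +oo%E)).
Qed.

Let mweight f : measurable_fun setT (fun x => ((sqnorm (f x))%:E * rho x)%E).
Proof.
by apply: emeasurable_funM => //; exact/emeasurable_sqnorm/L2_measurable.
Qed.

Let weight_ge0 f x : (0 <= (sqnorm (f x))%:E * rho x)%E.
Proof. by rewrite mule_ge0// lee_fin sqnorm_ge0. Qed.

Lemma L2_weighted_eq0 f : L2_weighted mu rho f ->
  {ae mu, forall x, rho x = +oo%E -> f x = 0}.
Proof.
move=> fD; have : mu.-integrable setT (fun x => ((sqnorm (f x))%:E * rho x)%E).
  apply/integrableP; split => //.
  by under eq_integral do rewrite gee0_abs//.
move=> /(integrable_ae measurableT); apply: filterS => x /(_ I) + rx.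
rewrite rx; apply: contraPP => /eqP; rewrite -sqnorm_eq0 => f0.
by rewrite gt0_muley// lte_fin lt_neqAle eq_sym f0 sqnorm_ge0.
Qed.

Lemma L2_weighted_level f n : {ae mu, forall x, rho x = +oo%E -> f x = 0} ->
  L2_weighted mu rho (cutoff (level n) f).
Proof.
move=> f0; rewrite /L2_weighted /=; apply: (@le_lt_trans _ _ (n%:R * hsq f)%:E); last by rewrite ltry.
rewrite EFinM hsqE -ge0_integralZl//; last 2 first.
- exact/emeasurable_sqnorm/L2_measurable.
- by move=> x _; rewrite lee_fin sqnorm_ge0.
apply: ae_ge0_le_integral => //.
- by move=> x _; rewrite -EFinM lee_fin mulr_ge0 ?sqnorm_ge0.
- by apply: emeasurable_funM => //; exact/emeasurable_sqnorm/L2_measurable.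
move: f0 (cutoffE f (mlevel n)); apply: filterS2 => x f0 -> _.
rewrite sqnormM indic_toC sqnormR indicE.
have [|_] := boolP (x \in level n); last first.
  by rewrite expr0n mul0r mul0e -EFinM lee_fin mulr_ge0 ?sqnorm_ge0.
rewrite inE /level /sublevel /= expr1n mul1r => rn.
have [/f0 ->|roo] := eqVneq (rho x) +oo%E; first by rewrite sqnorm0 mul0e mule0.
rewrite -[rho x]fineK ?ge0_fin_numE ?ltey//.
by rewrite -!EFinM lee_fin mulrC ler_wpM2r ?sqnorm_ge0.
Qed.

(** Elements of the weighted space vanish where [rho] is infinite, which is a
    closed condition; conversely the truncations to the sets where [rho] is
    bounded belong to it. *)
Lemma hclosure_L2_weighted :
  hclosure (L2_weighted mu rho) = L2_on mu [set x | (rho x < +oo)%E].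
Proof.
apply/seteqP; split=> f.
  move=> /hclosureP fD; apply/L2_onP.
  suff r0 : cutoff [set x | rho x = +oo%E] f = 0.
    apply: filterS (cutoff_eq0 minfty r0) => x f0 /negP.
    by rewrite ltey negbK => /eqP.
  apply: hsq_eq0; apply/eqP; rewrite eq_le hsq_ge0 andbT leNgt; apply/negP => h0.
  have [y yD] := fD _ h0; rewrite ltNge => /negP; apply.
  rewrite -[X in _ <= X]mul1r; apply: hsq_le => //.
  move: (L2_weighted_eq0 yD) (cutoffE f minfty) (L2_subE f y).
  apply: filterS3 => x y0 -> ->.
  rewrite mul1r sqnormM indic_toC sqnormR indicE.
  have [|_] := boolP (x \in _); last by rewrite expr0n mul0r sqnorm_ge0.
  by rewrite inE /= => /y0 ->; rewrite subr0 expr1n mul1r.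
move=> /L2_onP f0; apply/hclosureP => e e0.
have [n fn] := cutoff_approx f mfrho e0.
exists (cutoff (level n) f) => //; apply: L2_weighted_level.
by apply: filterS f0 => x f0 rx; apply: f0; rewrite /= rx ltxx.
Qed.

Lemma orthocomp_L2_weighted :
  orthocomp (L2_weighted mu rho) = L2_on mu [set x | rho x = +oo%E].
Proof.
apply/seteqP; split=> f; last first.
  move=> /L2_onP f0 y /L2_weighted_eq0 y0; apply: inner_ae0.
  move: f0 y0; apply: filterS2 => x f0 y0.
  have [/y0 ->|/eqP/f0 ->] := eqVneq (rho x) +oo%E; last by rewrite mul0r.
  by rewrite rmorph0 mulr0.
move=> oD; apply/L2_onP.
have mC : measurable (~` [set x | rho x = +oo%E]) by exact: measurableC.
apply: (cutoff_eq0 mC); set g := cutoff _ f.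
have gE := cutoffE f mC; rewrite -/g in gE.
(* The truncations of [g] belong to the weighted space, and [<f, gn> = |gn|^2]. *)
have gn n : cutoff (level n) g = 0.
  apply: hsq_eq0; rewrite /hsq (_ : inner _ _ = inner f (cutoff (level n) g)).
    rewrite oD//; apply: L2_weighted_level; apply: filterS gE => x -> rx.
    by rewrite indicE memNset ?mul0r//= => /(_ rx).
  apply: inner_ae; move: gE (cutoffE g (mlevel n)); apply: filterS2 => x gx ->.
  rewrite gx !indicE; case: (x \in level n); case: (x \in ~` _);
    by rewrite ?mul1r ?mul0r ?mulr0 ?rmorph0 ?mulr0.
apply: hsq_eq0; apply/eqP; rewrite eq_le hsq_ge0 andbT leNgt; apply/negP => g0.
by have [n] := cutoff_approx g mfrho g0; rewrite [cutoff _ _]gn subr0 ltxx.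
Qed.

End weighted_L2.

(** * Multiplication operators and the uniqueness of positive square roots *)

Lemma ae_and (R : realType) d (X : measurableType d) (mu : {measure set X -> \bar R})
    (P Q : X -> Prop) : {ae mu, forall x, P x} -> {ae mu, forall x, Q x} ->
  {ae mu, forall x, P x /\ Q x}.
Proof. by apply: filterS2 => x. Qed.

Lemma conj_realM (R : realType) (r : R) (z : R[i]) :
  Num.conj (r%:C * z) = r%:C * Num.conj z.
Proof. by case: z => p q; congr (_ +i* _) => /=; ring. Qed.

Section multiplication_operator.
Context {R : realType} {d : measure_display} {X : measurableType d}.
Variable mu : {measure set X -> \bar R}.
Implicit Types (f g u v z : L2 mu) (S : set X).

Variable a : X -> R.

Definition mulop : set (L2 mu * L2 mu) :=
  [set p : L2 mu * L2 mu | {ae mu, forall x, p.2 x = (a x)%:C * p.1 x}].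

Hypotheses (ma : measurable_fun setT a) (a0 : forall x, 0 <= a x).

Lemma mulop_symmetric u u' v v' :
  mulop (u, u') -> mulop (v, v') -> inner u' v = inner u v'.
Proof.
move=> uu vv; apply: inner_ae; move: uu vv; apply: filterS2 => x /= -> ->.
by rewrite conj_realM mulrCA mulrA.
Qed.

Lemma mulop_bounded_support f (t : R) :
  {ae mu, forall x, f x != 0 -> a x <= t} -> exists g, mulop (f, g).
Proof.
move=> ft; apply: (@L2_dominated _ _ _ mu (fun x => (a x)%:C * f x) f (t ^+ 2)).
- exact: sqr_ge0.
- by apply: cmeasurableM (L2_measurable f); exact: cmeasurable_real.
apply: filterS ft => x ft; rewrite sqnormM sqnormR.
have [->|/ft fxt] := eqVneq (f x) 0; first by rewrite sqnorm0 !mulr0.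
by rewrite ler_wpM2r ?sqnorm_ge0// lerXn2r// nnegrE// (le_trans (a0 x)).
Qed.

Lemma cutoff_sublevel_support f n :
  {ae mu, forall x, cutoff (sublevel a n) f x != 0 -> a x <= n%:R}.
Proof.
apply: filterS (cutoffE f (measurable_sublevel n ma)) => x ->.
by rewrite indicE; have [/[!inE]//|_] := boolP (x \in _); rewrite mul0r eqxx.
Qed.

Lemma mulop_dense : hdense (op_dom mulop).
Proof.
apply/seteqP; split=> // f _; apply/hclosureP => e e0.
have [n fn] := cutoff_approx f ma e0.
exists (cutoff (sublevel a n) f) => //.
exact: mulop_bounded_support (cutoff_sublevel_support f n).
Qed.

(** The functions supported in a sublevel set of [a] form a core: testing
    against [z = 1_(a <= n) (v - a u)] gives [|z|^2 = 0] for every [n]. *)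
Lemma mulop_adjoint_core u v :
  (forall n z z', {ae mu, forall x, z x != 0 -> a x <= n%:R} -> mulop (z, z') ->
    inner z' u = inner z v) -> mulop (u, v).
Proof.
move=> H.
suff key n : {ae mu, forall x, a x <= n%:R -> v x = (a x)%:C * u x}.
  apply: filterS (ae_foralln key) => x /(_ (Num.truncn (a x)).+1); apply.
  by rewrite ltW// truncnS_gt.
pose S := sublevel a n; have mS : measurable S by exact: measurable_sublevel.
have [w wE] := mulop_bounded_support (cutoff_sublevel_support u n).
have vE := cutoffE v mS; have uE := cutoffE u mS.
pose z : L2 mu := cutoff S v - w.
have zE : {ae mu, forall x, z x = \1_S x * (v x - (a x)%:C * u x)}.
  have wE' : {ae mu, forall x, w x = (a x)%:C * (\1_S x * u x)}.
    by move: wE uE; apply: filterS2 => x /= -> ->.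
  rewrite /z; move: (L2_subE (cutoff S v) w) wE' vE.
  apply: filterS3 => x -> -> ->.
  by rewrite mulrBr [in RHS]mulrCA.
have zS : {ae mu, forall x, z x != 0 -> a x <= n%:R}.
  apply: filterS zE => x ->; rewrite indicE.
  by have [/[!inE]//|_] := boolP (x \in S); rewrite mul0r eqxx.
have [z' zz'] := mulop_bounded_support zS.
have z0 : z = 0.
  apply: hsq_eq0; rewrite /hsq {2}/z innerBr.
  rewrite (_ : inner z (cutoff S v) = inner z v); last first.
    apply: inner_ae; move: zE vE; apply: filterS2 => x -> ->; rewrite indicE.
    by case: (x \in S); rewrite ?mul1r// !mul0r.
  suff -> : inner z w = inner z' u by rewrite (H _ _ _ zS zz') subrr.
  rewrite -(mulop_symmetric zz' wE); apply: inner_ae.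
  move: zE zz' uE; apply: filterS3 => x zx /= -> ->.
  by rewrite zx indicE; case: (x \in S); rewrite ?mul1r// !mul0r mulr0 !mul0r.
move: zE; rewrite z0; move: (L2_0E mu); apply: filterS2 => x -> + ax.
by rewrite indicE mem_set// mul1r => /esym/eqP; rewrite subr_eq0 => /eqP.
Qed.

Lemma mulop_selfadjoint : selfadjoint mulop.
Proof.
split; first exact: mulop_dense.
apply/seteqP; split=> -[u v] /=; last first.
  by move=> uv x y xy; exact: mulop_symmetric xy uv.
by move=> H; apply: mulop_adjoint_core => n z z' _; exact: H.
Qed.

Lemma mulop_positive : positive_op mulop.
Proof.
suff key (x y : L2 mu) : mulop (x, y) -> 0 <= inner y x by exact: key.
(* [inner y x] is the squared norm of [s = sqrt a x], which is square integrable
   since [a <= (1 + a)^2] and [(1 + a) x = x + y]. *)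
move=> xy; have [|||s sE] := @L2_dominated _ _ _ mu (fun t => (Num.sqrt (a t))%:C * x t) (x + y) 1 => //.
- apply: cmeasurableM (L2_measurable x); apply: cmeasurable_real.
  exact: (measurableT_comp (continuous_measurable_fun (@sqrt_continuous R))).
- move: xy (L2_addE x y); apply: filterS2 => t /= -> ->.
  rewrite mul1r -{2}[x t]mul1r -mulrDl !sqnormM ler_wpM2r ?sqnorm_ge0//.
  rewrite -[1 + _](_ : (1 + a t)%:C = _); last by rewrite rmorphD.
  rewrite !sqnormR sqr_sqrtr//; have := a0 t; have := sqr_ge0 (a t); rewrite sqrrD; lra.
rewrite (_ : inner y x = inner s s) ?dnorm_ge0//.
apply: inner_ae; move: xy sE; apply: filterS2 => t /= -> ->.
rewrite conj_realM mulrACA -rmorphM/= -expr2 sqr_sqrtr//.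
by rewrite mulrA.
Qed.

Lemma mulop_square f g :
  op_comp mulop mulop (f, g) <-> {ae mu, forall x, g x = (a x ^+ 2)%:C * f x}.
Proof.
split=> [[k /= fk kg]|gE].
  by move: fk kg; apply: filterS2 => x /= -> ->; rewrite mulrA -rmorphM.
(* The intermediate function is dominated: [a^2 <= (1 + a^2)^2]. *)
have [|||k kE] := @L2_dominated _ _ _ mu (fun t => (a t)%:C * f t) (f + g) 1 => //.
- by apply: cmeasurableM (L2_measurable f); exact: cmeasurable_real.
- move: gE (L2_addE f g); apply: filterS2 => t -> ->.
  rewrite mul1r -{2}[f t]mul1r -mulrDl !sqnormM ler_wpM2r ?sqnorm_ge0//.
  rewrite -[1 + _](_ : (1 + a t ^+ 2)%:C = _); last by rewrite rmorphD.
  rewrite !sqnormR sqrrD; have := sqr_ge0 (a t); have := sqr_ge0 (a t ^+ 2).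
  move: (_ ^+ 2) (_ ^+ 2) => p q; rewrite expr1n; lra.
exists k; first exact: kE.
by move: gE kE; apply: filterS2 => x /= -> ->; rewrite mulrA -rmorphM.
Qed.

Section square_root_unique.
Variable B : set (L2 mu * L2 mu).
Hypotheses (sB : selfadjoint B) (pB : positive_op B).
Hypothesis BB : op_comp B B = op_comp mulop mulop.

Let lB := selfadjoint_linear sB.

(** On functions on which [a] is bounded, [A^2 = B^2] is defined, hence so is
    [B]. *)
Let square_exists f (t : R) : {ae mu, forall x, f x != 0 -> a x <= t} ->
  exists g h, [/\ B (f, g), B (g, h) & {ae mu, forall x, h x = (a x ^+ 2)%:C * f x}].
Proof.
move=> ft; have [f' ff'] := mulop_bounded_support ft.
have [|h fh] := @mulop_bounded_support f' t.
  move: ff' ft; apply: filterS2 => x /= -> + fx; apply.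
  by apply: contraNN fx => /eqP ->; rewrite mulr0.
have : op_comp mulop mulop (f, h) by exists f'.
rewrite -BB => -[g /= fg gh]; exists g, h; split => //.
by apply/mulop_square; exists f'.
Qed.

(** The estimate [|(B - A)f|^2 <= c e^2 |f|^2] for [f] living on a slab of
    width [e]. *)
Let slab (c : R) := forall f (s e : R), 0 <= s -> 0 < e ->
  {ae mu, forall x, f x != 0 -> s <= a x < s + e} ->
  forall g f', B (f, g) -> mulop (f, f') -> hsq (g - f') <= c * e ^+ 2 * hsq f.

Let slab_le f s e : {ae mu, forall x, f x != 0 -> s <= a x < s + e} ->
  {ae mu, forall x, f x != 0 -> a x <= s + e}.
Proof. by apply: filterS => x + /[dup] f0 => /[apply] /andP[_ /ltW]. Qed.

(** Let [k = (B - s)f]. If [s >= e], then [|(B + s)k| >= s |k|] by positivity,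
    while [(B + s)k = (a^2 - s^2) f] has norm at most [3 s e |f|]; so
    [|k| <= 3 e |f|], whereas [|(A - s)f| <= e |f|]. If [s < e], then
    [|Bf| = |Af| <= 2 e |f|] already. *)
Let slab20 : slab 20.
Proof.
move=> f s e s0 e0 fS g f' Bfg ff'.
have [g2 [h [Bfg2 Bgh hE]]] := square_exists (slab_le fS).
have gg : g2 = g by exact: (linear_op_fun lB Bfg2 Bfg).
rewrite {}gg {g2 Bfg2} in Bgh.
have [se|es] := ltP s e.
  have gf' : hsq g = hsq f'.
    rewrite /hsq (selfadjoint_inner sB Bfg Bgh); congr Re; apply: inner_ae.
    move: ff' hE; apply: filterS2 => x /= -> ->.
    by rewrite !conj_realM expr2 rmorphM; ring.
  have f'_le : hsq f' <= (2 * e) ^+ 2 * hsq f.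
    apply: hsq_le; first exact: sqr_ge0.
    move: ff' fS; apply: filterS2 => x /= -> fS.
    rewrite sqnormM sqnormR.
    have [->|/fS/andP[_ ax]] := eqVneq (f x) 0; first by rewrite sqnorm0 !mulr0.
    rewrite ler_wpM2r ?sqnorm_ge0// lerXn2r// ?nnegrE// ?mulr_ge0// ?ltW//.
    lra.
  have := hsqB_le g f'; rewrite gf'.
  have := hsq_ge0 f; have := sqr_ge0 e; move: f'_le; rewrite exprMn.
  have := mulr_ge0 (sqr_ge0 e) (hsq_ge0 f).
  move: (e ^+ 2) (hsq f) (hsq f') (hsq _) => p q r t; nra.
pose k := g - s%:C *: f; pose l := h - s%:C *: g.
have Bkl : B (k, l) by exact: (linear_opB lB Bgh (linear_opZ s%:C lB Bfg)).
have k_le : hsq k <= 9 * e ^+ 2 * hsq f.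
  have : s ^+ 2 * hsq k <= hsq (l + s%:C *: k).
    rewrite (hsqD l) hsqZ sqnormR innerZr.
    have := pB Bkl; have := hsq_ge0 l.
    case: (inner l k) => p q; rewrite lecE /= => l0 /andP[_ p0].
    have := mulr_ge0 s0 p0; lra.
  have : hsq (l + s%:C *: k) <= (3 * (s * e)) ^+ 2 * hsq f.
    have -> : l + s%:C *: k = h - (s ^+ 2)%:C *: f.
      by rewrite /l /k scalerBr scalerA -rmorphM/= addrA subrK expr2.
    apply: hsq_le; first exact: sqr_ge0.
    move: (L2_subE h ((s ^+ 2)%:C *: f)) (L2_scaleE (s ^+ 2)%:C f) (ae_and hE fS).
    apply: filterS3 => x -> -> [-> fSx].
    rewrite -mulrBl -rmorphB sqnormM sqnormR.
    have [->|/fSx/andP[sa ax]] := eqVneq (f x) 0; first by rewrite sqnorm0 !mulr0.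
    rewrite ler_wpM2r ?sqnorm_ge0// lerXn2r// ?nnegrE; last 1 first.
    - rewrite subr_sqr; nra.
    - by rewrite subr_ge0 lerXn2r// nnegrE.
    - by rewrite !mulr_ge0// ltW.
  have [s00|s_gt0] := eqVneq s 0; first by move: es; rewrite s00 leNgt e0.
  have {s_gt0} s_gt0 : 0 < s ^+ 2 by rewrite exprn_gt0// lt_neqAle eq_sym s_gt0.
  move=> h1 h2; rewrite -(ler_pM2l s_gt0); apply: le_trans h2 _; apply: le_trans h1 _.
  by rewrite !exprMn; rewrite le_eqVlt; apply/orP; left; apply/eqP; ring.
have f'_le : hsq (f' - s%:C *: f) <= e ^+ 2 * hsq f.
  apply: hsq_le; first exact: sqr_ge0.
  move: (L2_subE f' (s%:C *: f)) (L2_scaleE s%:C f) (ae_and ff' fS).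
  apply: filterS3 => x -> -> [/= -> fSx].
  rewrite -mulrBl -rmorphB sqnormM sqnormR.
  have [->|/fSx/andP[sa ax]] := eqVneq (f x) 0; first by rewrite sqnorm0 !mulr0.
  by rewrite ler_wpM2r ?sqnorm_ge0// lerXn2r// ?nnegrE; lra.
have -> : g - f' = k - (f' - s%:C *: f) by rewrite /k opprB addrA subrK.
have := hsqB_le k (f' - s%:C *: f).
move: k_le f'_le; move: (hsq k) (hsq f) (hsq _) (hsq _) (e ^+ 2) => p q r t v; lra.
Qed.

(** The two halves of a slab have half the width, and the squared norms of the
    two pieces of [f] add up: the bound [|u + v|^2 <= 2 |u|^2 + 2 |v|^2] costs a
    factor 2, the halved width gains a factor 4. *)
Let slab_half c : slab c -> slab (c / 2).
Proof.
move=> sc f s e s0 e0 fS g f' Bfg ff'.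
pose S := [set x | a x < s + e / 2].
have mS : measurable S.
  have -> : S = [set: X] `&` a @^-1` `]-oo, s + e / 2[.
    by rewrite setTI; apply/seteqP; split=> x /=; rewrite in_itv.
  exact: ma.
have e2 : 0 < e / 2 by rewrite divr_gt0.
pose f1 : L2 mu := cutoff S f; have f1E : {ae mu, forall x, f1 x = \1_S x * f x} := cutoffE f mS.
pose f2 : L2 mu := f - f1; have f2E : {ae mu, forall x, f2 x = f x - f1 x} := L2_subE f f1.
have f1S : {ae mu, forall x, f1 x != 0 -> s <= a x < s + e / 2}.
  move: f1E fS; apply: filterS2 => x -> fSx; rewrite indicE.
  have [/[!inE] Sx|_] := boolP (x \in S); last by rewrite mul0r eqxx.
  by rewrite mul1r => /fSx/andP[-> _] /=.
have f2S : {ae mu, forall x, f2 x != 0 -> s + e / 2 <= a x < s + e / 2 + e / 2}.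
  move: f2E f1E fS; apply: filterS3 => x -> -> fSx; rewrite indicE.
  have [_|] := boolP (x \in S); first by rewrite mul1r subrr eqxx.
  rewrite notin_setE mul0r subr0 /S /= => /negP; rewrite -leNgt => ax /fSx/andP[_ ax'].
  by rewrite ax -addrA -splitr.
have [g1 [_ [Bfg1 _ _]]] := square_exists (slab_le f1S).
have [f1' ff1'] := mulop_bounded_support (slab_le f1S).
have Bfg2 : B (f2, g - g1) by exact: (linear_opB lB Bfg Bfg1).
have lA := selfadjoint_linear mulop_selfadjoint.
have ff2' : mulop (f2, f' - f1') by exact: (linear_opB lA ff' ff1').
have h1 := sc _ _ _ s0 e2 f1S _ _ Bfg1 ff1'.
have h2 := sc _ _ _ (addr_ge0 s0 (ltW e2)) e2 f2S _ _ Bfg2 ff2'.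
have -> : g - f' = (g1 - f1') + ((g - g1) - (f' - f1')).
  by rewrite opprB addrACA [g1 + _]addrC subrK addKr.
apply: le_trans (hsqD_le _ _) _.
move: h2; rewrite /f2 /f1 hsqB_cutoff// -/f1 => h2.
have := lerD h1 h2; rewrite -mulrDr [hsq f1 + _]addrC subrK.
rewrite expr_div_n; move: (hsq f) (hsq _) (hsq _) (e ^+ 2) => p q r t; lra.
Qed.

Let mulop_sub_root f f' (t : R) : {ae mu, forall x, f x != 0 -> a x <= t} ->
  mulop (f, f') -> B (f, f').
Proof.
move=> ft ff'; have [g [_ [Bfg _ _]]] := square_exists ft.
suff <- : g = f' by [].
apply/eqP; rewrite -subr_eq0; apply/eqP/hsq_eq0/eqP.
rewrite eq_le hsq_ge0 andbT leNgt; apply/negP => d0.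
pose e := `|t| + 1; have e0 : 0 < e by rewrite ltr_wpDl.
have fS : {ae mu, forall x, f x != 0 -> 0 <= a x < 0 + e}.
  apply: filterS ft => x + fx => /(_ fx) ax.
  by rewrite a0 add0r/= (le_lt_trans (le_trans ax (ler_norm _)))// ltrDl.
have sn n : slab (20 / 2 ^+ n).
  elim: n => [|n IH]; first by rewrite expr0 divr1; exact: slab20.
  by rewrite exprSr invfM mulrA; exact: slab_half.
pose K := 20 * e ^+ 2 * hsq f / hsq (g - f').
have := sn (Num.truncn K).+1 f 0 e (lexx 0) e0 fS g f' Bfg ff'.
rewrite leNgt => /negP; apply.
set n := (Num.truncn K).+1.
have Kn : K < 2 ^+ n.
  by rewrite (lt_trans (truncnS_gt K))// -natrX ltr_nat ltn_expl.
rewrite -[X in X < _](_ : 20 * e ^+ 2 * hsq f / 2 ^+ n = _); last by ring.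
rewrite ltr_pdivrMr ?exprn_gt0// [X in _ < X]mulrC.
by move: Kn; rewrite /K ltr_pdivrMr.
Qed.

(** [B] extends [A] on a core; symmetry of [B] against that core gives
    [B <= A], and then [A = A^* <= B^* = B]. *)
Lemma mulop_root_unique : B = mulop.
Proof.
have BA : B `<=` mulop.
  move=> [u v] Buv; apply: mulop_adjoint_core => n z z' zn zz'.
  exact: (selfadjoint_inner sB (mulop_sub_root zn zz') Buv).
apply/seteqP; split => // -[u v] uv; apply: selfadjointP => // x x' /BA xx'.
exact: mulop_symmetric xx' uv.
Qed.

End square_root_unique.
End multiplication_operator.
Arguments mulop {R d X} mu a.

(** * Change of variables *)

Section change_of_variables.
Context {R : realType}.
Local Open Scope ereal_scope.
Import HBNNSimple.

(** Stated for a map [psi] so that it applies to both sides of the change of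
    variables, with [psi = phi] and with [psi = id]. *)
Let integral_nnsfun d d' (T : measurableType d) (Y : measurableType d')
    (m : {measure set T -> \bar R}) (psi : T -> Y) (q : T -> \bar R)
    (g : {nnsfun Y >-> R}) :
  measurable_fun setT psi -> measurable_fun setT q -> (forall x, 0 <= q x) ->
  \int[m]_x ((g (psi x))%:E * q x) =
  \sum_(c \in range g) c%:E * \int[m]_(x in psi @^-1` (g @^-1` [set c])) q x.
Proof.
move=> mpsi mq q0.
have mA c : measurable (psi @^-1` (g @^-1` [set c])).
  by rewrite -[X in measurable X]setTI; apply: mpsi.
have c0 c x : 0 <= (c * \1_(g @^-1` [set c]) (psi x))%:E.
  exact: nnfun_muleindic_ge0.
transitivity (\int[m]_x (\sum_(c \in range g)
    (c * \1_(g @^-1` [set c]) (psi x))%:E * q x)).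
  apply: eq_integral => x _; rewrite fimfunE -fsumEFin// ge0_mule_fsuml//.
have mi c : measurable_fun setT (fun x => (\1_(g @^-1` [set c]) (psi x) : R)%:E).
  by apply/measurable_EFinP; exact: (measurable_indic (mA c)).
rewrite ge0_integral_fsum//; last 2 first.
- move=> c; apply: emeasurable_funM => //; under eq_fun do rewrite EFinM.
  exact: emeasurable_funM.
- by move=> c x _; rewrite mule_ge0.
apply: eq_fsbigr => c; rewrite inE => -[y _ gc].
under eq_integral do rewrite EFinM -muleA.
rewrite ge0_integralZl//.
- rewrite [in RHS]integral_mkcond epatch_indic; congr (_ * _).
  by apply: eq_integral => x _ /=; rewrite muleC.
- exact: emeasurable_funM.
- by move=> x _; rewrite mule_ge0// lee_fin.
- by rewrite lee_fin -gc.
Qed.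

Context {d d' : measure_display} {X : measurableType d} {Y : measurableType d'}.

(** The bound by the limit is needed when [c = +oo] and [l = 0], where
    multiplication is discontinuous. *)
Let cvgeZr_ge0 (u : nat -> \bar R) l c : (forall n, 0 <= u n <= l) -> 0 <= c ->
  u n @[n --> \oo] --> l -> u n * c @[n --> \oo] --> l * c.
Proof.
move=> ul c0 cu; have [cf|] := boolP (c \is a fin_num); first exact: cvgeZr.
rewrite ge0_fin_numE// ltey negbK => /eqP ->.
have [l0|l0] := eqVneq l 0.
  rewrite l0 mul0e [X in X @ _](_ : _ = cst 0); first exact: cvg_cst.
  by apply/funext => n; have := ul n; rewrite l0 -eq_le => /eqP <-; rewrite mul0e.
apply: cvgeM => //; last exact: cvg_cst.
by rewrite mule_def_neq0_infty.
Qed.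

(** The general form, with densities on both sides, covers Radon-Nikodym
    derivatives, the passage between [mu] and [|w|^2 dmu], and conditional
    expectations. *)
Lemma ge0_change_of_variables (nu : {measure set X -> \bar R})
    (mu : {measure set Y -> \bar R}) (phi : X -> Y)
    (k : X -> \bar R) (r f : Y -> \bar R) :
  measurable_fun setT phi ->
  measurable_fun setT k -> (forall x, 0 <= k x) ->
  measurable_fun setT r -> (forall y, 0 <= r y) ->
  (forall D, measurable D ->
    \int[nu]_(x in phi @^-1` D) k x = \int[mu]_(y in D) r y) ->
  measurable_fun setT f -> (forall y, 0 <= f y) ->
  \int[nu]_x (f (phi x) * k x) = \int[mu]_y (f y * r y).
Proof.
move=> mphi mk k0 mr r0 kr mf f0.
pose f_ := nnsfun_approx measurableT mf.
have f_f y : (f_ n y)%:E @[n --> \oo] --> f y by exact: cvg_nnsfun_approx.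
have le_f n y : (f_ n y)%:E <= f y.
  by rewrite /f_ nnsfun_approxE le_approx.
have nd y : nondecreasing_seq (fun n => (f_ n y)%:E).
  by move=> m n mn; rewrite lee_fin; exact/lefP/nd_nnsfun_approx.
have mf_ n : measurable_fun setT (fun y => (f_ n y)%:E).
  by apply/measurable_EFinP.
transitivity (limn (fun n => \int[nu]_x ((f_ n (phi x))%:E * k x))).
  rewrite -monotone_convergence//.
  - by apply: eq_integral => x _; apply/esym/cvg_lim => //; apply: cvgeZr_ge0 => // n; rewrite lee_fin fun_ge0 /=; exact: le_f.
  - by move=> n; apply: emeasurable_funM => //; exact: (measurableT_comp (mf_ n) mphi).
  - by move=> n x _; rewrite mule_ge0// lee_fin.
  - by move=> x _ m n mn; rewrite lee_wpmul2r//; exact: nd.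
transitivity (limn (fun n => \int[mu]_y ((f_ n y)%:E * r y))); last first.
  rewrite -monotone_convergence//.
  - by apply: eq_integral => y _; apply/cvg_lim => //; apply: cvgeZr_ge0 => // n; rewrite lee_fin fun_ge0 /=; exact: le_f.
  - by move=> n; apply: emeasurable_funM.
  - by move=> n x _; rewrite mule_ge0// lee_fin.
  - by move=> x _ m n mn; rewrite lee_wpmul2r//; exact: nd.
congr (limn _); apply/funext => n.
rewrite (integral_nnsfun nu (f_ n) mphi)// (integral_nnsfun mu (f_ n) (@measurable_id _ _ setT))//.
by apply: eq_fsbigr => c _; rewrite kr.
Qed.

End change_of_variables.

(** * Weighted composition operators *)

Section null_preserving.
Context {R : realType} {d : measure_display} {X : measurableType d}.
Variable mu : {measure set X -> \bar R}.
Implicit Types (phi : X -> X) (w : X -> R[i]).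

(** This is [mu_w o phi^-1 << mu] in pointwise form: it lets an almost everywhere
    statement be used at [phi x] wherever [w x] is nonzero. In particular the
    operator does not depend on the representatives in L2. *)
Definition null_preserving phi w := forall P : X -> Prop,
  {ae mu, forall x, P x} -> {ae mu, forall x, w x != 0 -> P (phi x)}.

Lemma dominates_null_preserving phi w (mw : cmeasurable w) :
  measurable_fun setT phi -> pushforward (wmeasure mu mw) phi `<< mu ->
  null_preserving phi w.
Proof.
move=> mphi ac P [N [mN N0 PN]].
have mpN : measurable (phi @^-1` N) by rewrite -[X in measurable X]setTI; exact: mphi.
have : (\int[mu]_(x in phi @^-1` N) `|(sqnorm (w x))%:E| = 0)%E.
  under eq_integral do rewrite gee0_abs ?lee_fin ?sqnorm_ge0//.
  by move/null_content_dominatesP: ac; exact.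
move=> /(ae_eq_integral_abs mu mpN)[].
  exact/measurable_funTS/emeasurable_sqnorm.
move=> M [mM M0 wM]; exists M; split => // x /= /not_implyP[w0 nP].
apply: wM => /= /(_ (PN _ nP)) [] /eqP; rewrite sqnorm_eq0; exact/negP.
Qed.

Lemma null_preservingS phi w v : (forall x, v x != 0 -> w x != 0) ->
  null_preserving phi w -> null_preserving phi v.
Proof. by move=> vw pw P /pw; apply: filterS => x Px /vw. Qed.

Lemma wcomp_linear phi w : null_preserving phi w -> linear_op (wcomp mu phi w).
Proof.
move=> pw; split.
- move: (L2_0E mu) (pw _ (L2_0E mu)); apply: filterS2 => x /= -> w0.
  by have [->|/w0 ->] := eqVneq (w x) 0; rewrite ?mul0r ?mulr0.
- move=> a [f g] [f' g'] /= fg fg'.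
  move: (L2_linE a g g') (ae_and fg fg') (pw _ (L2_linE a f f')).
  apply: filterS3 => x /= -> [-> ->] w0.
  have [->|/w0 ->] := eqVneq (w x) 0; first by rewrite !mul0r mulr0 addr0.
  by rewrite mulrDr [in RHS]mulrCA.
- move=> y /= wy; apply/L2_eqP; move: wy (pw _ (L2_0E mu)) (L2_0E mu).
  apply: filterS3 => x -> w0 ->.
  by have [->|/w0 ->] := eqVneq (w x) 0; rewrite ?mul0r ?mulr0.
Qed.

End null_preserving.


Section one_weighted_composition.
Context {R : realType} {d : measure_display} {X : measurableType d}.
Variable mu : {measure set X -> \bar R}.
Variables (phi : X -> X) (w : X -> R[i]).
Hypotheses (mphi : measurable_fun setT phi) (mw : cmeasurable w).
Hypothesis pw : null_preserving mu phi w.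
Variable h : X -> \bar R.
Hypothesis hP : is_RN_derivative mu (pushforward (wmeasure mu mw) phi) h.
Implicit Types f g : L2 mu.

Let mh : measurable_fun setT h. Proof. by case: hP. Qed.
Let h0 x : (0 <= h x)%E. Proof. by case: hP. Qed.

Lemma integral_comp_weight (F : X -> \bar R) : measurable_fun setT F ->
  (forall x, 0 <= F x)%E ->
  (\int[mu]_x (F (phi x) * (sqnorm (w x))%:E) = \int[mu]_x (F x * h x))%E.
Proof.
move=> mF F0; apply: ge0_change_of_variables => //.
- exact: emeasurable_sqnorm.
- by move=> x; rewrite lee_fin sqnorm_ge0.
- by case: hP => _ _ + D mD => /(_ _ mD) <-.
Qed.

Lemma integral_wmeasure (F : X -> \bar R) D : measurable D ->
  measurable_fun setT F -> (forall x, 0 <= F x)%E ->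
  (\int[wmeasure mu mw]_(x in D) F x = \int[mu]_(x in D) (F x * (sqnorm (w x))%:E))%E.
Proof.
move=> mD mF F0; rewrite [LHS]integral_mkcond [RHS]integral_mkcond.
transitivity (\int[wmeasure mu mw]_x ((F \_ D) x * 1))%E.
  by apply: eq_integral => x _; rewrite mule1.
transitivity (\int[mu]_x ((F \_ D) (id x) * (sqnorm (w x))%:E))%E; last first.
  by apply: eq_integral => x _; rewrite /patch; case: (x \in D); rewrite ?mul0e.
symmetry; apply: ge0_change_of_variables => //.
- exact: emeasurable_sqnorm.
- by move=> x; rewrite lee_fin sqnorm_ge0.
- by move=> A mA; rewrite integral_cst// mul1e.
- exact/(measurable_restrictT _ mD)/measurable_funTS.
- by move=> x; apply: erestrict_ge0 => y _.
Qed.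

Lemma integral_sqnorm_comp (c : X -> R) f : measurable_fun setT c ->
  (\int[mu]_x (sqnorm ((c (phi x))%:C * w x * f (phi x)))%:E =
   \int[mu]_x ((sqnorm (f x))%:E * ((c x ^+ 2)%:E * h x)))%E.
Proof.
move=> mc.
have mf : measurable_fun setT (fun x => ((sqnorm (f x))%:E * (c x ^+ 2)%:E)%E).
  apply: emeasurable_funM; first exact/emeasurable_sqnorm/L2_measurable.
  by apply/measurable_EFinP; exact: measurable_funX.
under [RHS]eq_integral do rewrite muleA.
rewrite -(integral_comp_weight mf).
  apply: eq_integral => x _; rewrite -!EFinM !sqnormM sqnormR; congr EFin; ring.
by move=> x; rewrite -EFinM lee_fin mulr_ge0 ?sqnorm_ge0 ?sqr_ge0.
Qed.

Lemma wcomp_hsq f g : wcomp mu phi w (f, g) ->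
  ((hsq g)%:E = \int[mu]_x ((sqnorm (f x))%:E * h x))%E.
Proof.
move=> fg; have := integral_sqnorm_comp f (@measurable_cst _ _ X R setT 1).
under [in RHS]eq_integral do rewrite expr1n mul1e.
move=> <-; apply: hsq_aeE; last by apply: filterS fg => x /= ->; rewrite mul1r.
apply: cmeasurableM; last exact/(cmeasurable_comp mphi)/L2_measurable.
by apply: cmeasurableM => //; split; exact: measurable_cst.
Qed.

Lemma wcomp_dom : op_dom (wcomp mu phi w) = L2_weighted mu h.
Proof.
apply/seteqP; split=> f.
  by move=> [g fg]; rewrite /L2_weighted/= -(wcomp_hsq fg) ltry.
move=> fh; have [||g gE] := @L2_exists _ _ _ mu (fun x => w x * (f : L2 mu) (phi x)); last by exists g.
  by apply: cmeasurableM => //; exact/(cmeasurable_comp mphi)/L2_measurable.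
have := integral_sqnorm_comp f (@measurable_cst _ _ X R setT 1).
under [in RHS]eq_integral do rewrite expr1n mul1e.
by under eq_integral do rewrite mul1r; move=> ->.
Qed.

(** Every function in the closure of the domain vanishes where [h] is infinite;
    this applies to the indicators of a countable cover by sets of finite
    measure. *)
Lemma dense_RN_finite : sigma_finite setT mu -> hdense (op_dom (wcomp mu phi w)) ->
  {ae mu, forall x, (h x < +oo)%E}.
Proof.
move=> [F FT mF]; rewrite /hdense wcomp_dom hclosure_L2_weighted// => hT.
suff key n : {ae mu, forall x, F n x -> (h x < +oo)%E}.
  apply: filterS (ae_foralln key) => x hx.
  by have : [set: X] x by []; rewrite FT => -[n _ /hx].
have [mFn Fn] := mF n.
have [||u uE] := @L2_exists _ _ _ mu (fun x => \1_(F n) x).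
- exact: cmeasurable_indic.
- rewrite (_ : (\int[mu]_x _)%E = mu (F n))//.
  rewrite -[in RHS](setIT (F n)) -integral_indic//.
  by apply: eq_integral => x _; rewrite indic_toC sqnormR indicE; case: (_ \in _); rewrite ?expr1n ?expr0n.
have /L2_onP : L2_on mu [set x | (h x < +oo)%E] u by rewrite hT.
move: uE; apply: filterS2 => x -> + Fx.
rewrite indicE mem_set//= => h1; apply: contrapT => /h1/eqP; by rewrite oner_eq0.
Qed.

End one_weighted_composition.

(** * One component of the spherical mean transform *)

Lemma measurable_funV (R : realType) d (T : measurableType d) (f : T -> R) :
  measurable_fun setT f -> (forall x, 0 <= f x) ->
  measurable_fun setT (fun x => (f x)^-1).
Proof.
move=> mf f0; rewrite (_ : (fun x => _) = (fun x => f x `^ (-1))).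
  exact: (measurableT_comp (@measurable_powR R (-1)) mf).
by apply/funext => x; rewrite powR_inv1.
Qed.

Section spherical_component.
Context {R : realType} {d : measure_display} {X : measurableType d}.
Variable mu : {measure set X -> \bar R}.
Variables (phi : X -> X) (w : X -> R[i]).
Hypotheses (mphi : measurable_fun setT phi) (mw : cmeasurable w).
Hypothesis pw : null_preserving mu phi w.
Variable h : X -> \bar R.
Hypothesis hP : is_RN_derivative mu (pushforward (wmeasure mu mw) phi) h.
Variables (H E G : X -> \bar R).
Hypotheses (mH : measurable_fun setT H) (H0 : forall x, (0 <= H x)%E).
Hypothesis EP : is_cond_expectation (wmeasure mu mw) phi H E.
Hypothesis GP : is_pullback mu (wmeasure mu mw) phi h E G.
Variable a : X -> R.
Hypotheses (ma : measurable_fun setT a) (a0 : forall x, 0 <= a x).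
Hypothesis Ha : {ae mu, forall x, H x = (a x ^+ 2)%:E}.
Hypothesis hH : forall x, (h x <= H x)%E.
Implicit Types f g p q s z : L2 mu.

Let mh : measurable_fun setT h. Proof. by case: hP. Qed.
Let h0 x : (0 <= h x)%E. Proof. by case: hP. Qed.
Let mG : measurable_fun setT G. Proof. by case: GP. Qed.
Let G0 x : (0 <= G x)%E. Proof. by case: GP. Qed.

Let b x := (a x)^-1.

Let mb : measurable_fun setT b.
Proof. exact: measurable_funV. Qed.

(** The weight [w / (a o phi)] of the phase. Where [a (phi x)] vanishes the
    quotient is [0]; by [weight_support] this is harmless. *)
Definition phase_weight x : R[i] := (b (phi x))%:C * w x.
Let v := phase_weight.

Let mv : cmeasurable v.
Proof.
by apply: cmeasurableM => //; apply: cmeasurable_real; exact: measurableT_comp mb mphi.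
Qed.

Lemma measurable_cond_expectation : measurable_fun setT E.
Proof.
case: EP => mE _ _ _ B mB; have [D mD <-] := mE measurableT B mB.
by rewrite setTI -[X in measurable X]setTI; exact: mphi.
Qed.

(** Both sides are integrals against measures which agree on each [D]:
    integrating [H] over [phi^-1(D)] is integrating [E = G o phi] there. *)
Lemma integral_cond_expectation (F : X -> \bar R) : measurable_fun setT F ->
  (forall x, 0 <= F x)%E ->
  (\int[mu]_x (F (phi x) * (H x * (sqnorm (w x))%:E)) =
   \int[mu]_x (F x * (G x * h x)))%E.
Proof.
move=> mF F0.
have mpG : measurable_fun setT (fun x => G (phi x)) by exact: measurableT_comp mG mphi.
apply: (@ge0_change_of_variables _ _ _ _ _ mu mu phi (fun x => H x * (sqnorm (w x))%:E)%E
  (fun x => G x * h x)%E) => //.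
- by apply: emeasurable_funM => //; exact: emeasurable_sqnorm.
- by move=> x; rewrite mule_ge0// lee_fin sqnorm_ge0.
- exact: emeasurable_funM.
- by move=> x; rewrite mule_ge0.
move=> D mD; have mpD : measurable (phi @^-1` D) by rewrite -[X in measurable X]setTI; exact: mphi.
rewrite -(integral_wmeasure mu mw mpD)//.
have [_ E0 EE] := EP; rewrite EE//.
have [_ _ _ GE] := GP.
transitivity (\int[wmeasure mu mw]_(x in phi @^-1` D) G (phi x))%E.
  apply: ge0_ae_eq_integral => //.
  - exact/measurable_funTS/measurable_cond_expectation.
  - exact: measurable_funTS.
  - by apply: filterS GE => x ->.
rewrite (integral_wmeasure mu mw mpD)//.
transitivity (\int[mu]_x ((G \_ D) (phi x) * (sqnorm (w x))%:E))%E.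
  rewrite [LHS]integral_mkcond; apply: eq_integral => x _.
  by rewrite /patch (_ : (x \in phi @^-1` D) = (phi x \in D)); 
     [case: ifP => _ //; rewrite mul0e | apply/idP/idP; rewrite !inE].
rewrite (integral_comp_weight mphi hP).
- rewrite [RHS]integral_mkcond; apply: eq_integral => x _.
  by rewrite /patch; case: ifP => _ //; rewrite mul0e.
- exact/(measurable_restrictT _ mD)/measurable_funTS.
- by move=> x; apply: erestrict_ge0.
Qed.

(** The set [a = 0] carries no [h] since [h <= H = a^2], that is, its preimage
    under [phi] has no [|w|^2 dmu] mass. *)
Lemma weight_support : {ae mu, forall x, w x != 0 -> a (phi x) != 0}.
Proof.
pose S := [set x | a x = 0].
have mS : measurable S.
  rewrite -[X in measurable X]setTI; exact: (ma measurableT (measurable_set1 0)).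
pose F x := (\1_S x : R)%:E.
have mF : measurable_fun setT F by apply/measurable_EFinP; exact: measurable_indic.
have F0 x : (0 <= F x)%E by rewrite lee_fin.
have : (\int[mu]_x (F (phi x) * (sqnorm (w x))%:E) = 0)%E.
  rewrite (integral_comp_weight mphi hP)//.
  transitivity (\int[mu]_x (cst 0%E x : \bar R))%E; last by rewrite integral0.
  apply: ge0_ae_eq_integral => //.
  - exact: emeasurable_funM.
  - by move=> x _; rewrite mule_ge0.
  apply: filterS Ha => x Hx _; rewrite /F indicE.
  have [/[!inE] Sx|_] := boolP (x \in S); last by rewrite mul0e.
  have := hH x; rewrite Hx Sx expr0n => hx.
  by have -> : h x = 0%E by [apply/eqP; rewrite eq_le hx h0]; rewrite mule0.
move=> I0; have : (\int[mu]_x `|F (phi x) * (sqnorm (w x))%:E| = 0)%E.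
  rewrite -[RHS]I0; apply: eq_integral => x _; rewrite gee0_abs// mule_ge0// lee_fin sqnorm_ge0//.
move=> /(ae_eq_integral_abs mu measurableT)[].
  apply: emeasurable_funM; last exact: emeasurable_sqnorm.
  exact: measurableT_comp mF mphi.
move=> N [mN N0 sN]; exists N; split => // x nP; apply: sN => /= /(_ I).
apply: contra_not nP => + w0; rewrite /F indicE.
have [/[!inE] Sx|/negP nS] := boolP (phi x \in S).
  by rewrite mul1e => -[] /eqP; rewrite sqnorm_eq0 (negbTE w0).
by move=> _; apply/eqP => aS; apply: nS; rewrite inE.
Qed.

Let h_fin x : H x != +oo%E -> h x = (fine (h x))%:E.
Proof.
move=> Hx; rewrite fineK// ge0_fin_numE//.
by apply: le_lt_trans (hH x) _; rewrite ltey.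
Qed.

(** The conventions for the quotients at [H x = 0] and [H x = +oo] make both sides
    vanish, so this holds everywhere; it gives measurability, which an almost
    everywhere identity would not. *)
Lemma sfE_fine x : sfE H h G x = (G x * (fine (h x) / fine (H x))%:E)%E.
Proof.
rewrite /sfE; case: eqVneq => [->|Hx0]; first by rewrite /= invr0 mulr0 mule0.
congr (_ * _)%E; have [Hy|Hy] := eqVneq (H x) +oo%E.
  by rewrite Hy /= invr0 mulr0 invey mule0.
rewrite EFinM -h_fin//; congr (_ * _)%E.
have /fineK {1}<- : H x \is a fin_num by rewrite ge0_fin_numE// ltey.
rewrite inver ifF//; apply/negbTE; apply: contraNN Hx0 => /eqP H0'.
by rewrite -[H x]fineK ?H0'// ge0_fin_numE// ltey.
Qed.

Lemma sfE_ge0 x : (0 <= sfE H h G x)%E.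
Proof. by rewrite sfE_fine mule_ge0// lee_fin divr_ge0// fine_ge0. Qed.

Lemma measurable_sfE : measurable_fun setT (sfE H h G).
Proof.
rewrite (_ : sfE H h G = (fun x => G x * (fine (h x) / fine (H x))%:E)%E).
  apply: emeasurable_funM => //; apply/measurable_EFinP; apply: measurable_funM.
    by apply: measurableT_comp => //; exact: measurable_fine.
  apply: measurable_funV; last by move=> x; rewrite fine_ge0.
  by apply: measurableT_comp => //; exact: measurable_fine.
by apply/funext => x; exact: sfE_fine.
Qed.

Lemma sfE_ae : {ae mu, forall x, sfE H h G x = ((b x ^+ 2)%:E * (G x * h x))%E}.
Proof.
apply: filterS Ha => x Hx; rewrite sfE_fine (@h_fin x) ?Hx//= muleCA; congr (_ * _)%E.
by rewrite -EFinM /b exprVn mulrC.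
Qed.

Let cmeasurable_modulus_phase f : cmeasurable (fun x => (a x)%:C * (v x * f (phi x))).
Proof.
apply: cmeasurableM; first exact: cmeasurable_real.
by apply: cmeasurableM => //; exact/(cmeasurable_comp mphi)/L2_measurable.
Qed.

(** This is where the conditional expectation enters: the factor [H = a^2] is
    not a function of [phi x]. *)
Lemma integral_modulus_phase f :
  (\int[mu]_x (sqnorm ((a x)%:C * (v x * f (phi x))))%:E =
   \int[mu]_x ((sqnorm (f x))%:E * sfE H h G x))%E.
Proof.
have mf : measurable_fun setT (fun x => ((sqnorm (f x))%:E * (b x ^+ 2)%:E)%E).
  apply: emeasurable_funM; first exact/emeasurable_sqnorm/L2_measurable.
  by apply/measurable_EFinP; exact: measurable_funX.
transitivity (\int[mu]_x (((sqnorm (f (phi x)))%:E * (b (phi x) ^+ 2)%:E) *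
    (H x * (sqnorm (w x))%:E)))%E.
  apply: ge0_ae_eq_integral => //.
  - exact: emeasurable_sqnorm.
  - apply: emeasurable_funM; first exact: measurableT_comp mf mphi.
    by apply: emeasurable_funM => //; exact: emeasurable_sqnorm.
  - by move=> x _; rewrite lee_fin sqnorm_ge0.
  - by move=> x _; rewrite !mule_ge0 ?lee_fin ?sqnorm_ge0 ?sqr_ge0.
  apply: filterS Ha => x -> _; rewrite -!EFinM /v /phase_weight !sqnormM !sqnormR.
  by congr EFin; ring.
rewrite (integral_cond_expectation mf); last first.
  by move=> x; rewrite mule_ge0// lee_fin ?sqnorm_ge0 ?sqr_ge0.
apply: ge0_ae_eq_integral => //.
- by apply: emeasurable_funM => //; exact: emeasurable_funM.
- apply: emeasurable_funM measurable_sfE.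
  exact/emeasurable_sqnorm/L2_measurable.
- by move=> x _; rewrite !mule_ge0 ?lee_fin ?sqnorm_ge0 ?sqr_ge0.
- by move=> x _; rewrite mule_ge0 ?sfE_ge0// lee_fin sqnorm_ge0.
by apply: filterS sfE_ae => x -> _; rewrite -muleA.
Qed.

Lemma integral_phase f :
  (\int[mu]_x (sqnorm (v x * f (phi x)))%:E =
   \int[mu]_x ((sqnorm (f x))%:E * ((b x ^+ 2)%:E * h x)))%E.
Proof. exact: integral_sqnorm_comp. Qed.

Lemma phase_weight_null_preserving : null_preserving mu phi v.
Proof.
apply: null_preservingS pw => x; apply: contraNN => /eqP w0.
by rewrite /v /phase_weight w0 mulr0.
Qed.

(** [U] is everywhere defined since [a^-2 h <= a^-2 a^2 <= 1]. *)
Lemma phase_dom : op_dom (wcomp mu phi v) = setT.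
Proof.
apply/seteqP; split=> // f _.
have [||g gE] := @L2_exists _ _ _ mu (fun x => v x * (f : L2 mu) (phi x)); last by exists g.
  by apply: cmeasurableM => //; exact/(cmeasurable_comp mphi)/L2_measurable.
rewrite integral_phase; apply: le_lt_trans (L2_fin f).
apply: ae_ge0_le_integral => //.
- by move=> x _; rewrite !mule_ge0 ?lee_fin ?sqnorm_ge0 ?sqr_ge0.
- apply: emeasurable_funM; first exact/emeasurable_sqnorm/L2_measurable.
  apply: emeasurable_funM => //.
  by apply/measurable_EFinP; exact: measurable_funX.
- by move=> x _; rewrite lee_fin sqnorm_ge0.
- exact/emeasurable_sqnorm/L2_measurable.
apply: filterS Ha => x Hx _; rewrite -[leRHS]mule1 lee_wpmul2l ?lee_fin ?sqnorm_ge0//.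
apply: (@le_trans _ _ ((b x ^+ 2)%:E * (a x ^+ 2)%:E)%E).
  by rewrite lee_wpmul2l ?lee_fin ?sqr_ge0// -Hx.
rewrite -EFinM lee_fin /b; have [->|an0] := eqVneq (a x) 0.
  by rewrite expr0n mulr0.
by rewrite -exprMn mulVf// expr1n.
Qed.

Lemma phase_hsq f q : wcomp mu phi v (f, q) ->
  ((hsq q)%:E = \int[mu]_x ((sqnorm (f x))%:E * ((b x ^+ 2)%:E * h x)))%E.
Proof.
move=> fq; rewrite -integral_phase; apply: hsq_aeE fq.
by apply: cmeasurableM => //; exact/(cmeasurable_comp mphi)/L2_measurable.
Qed.

(** [U A = C]: dividing by [a \o phi] undoes the multiplication by [a]. *)
Lemma phase_modulusP f g z : mulop mu a (f, g) ->
  wcomp mu phi v (g, z) <-> wcomp mu phi w (f, z).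
Proof.
move=> fg.
suff vw : {ae mu, forall x, v x * g (phi x) = w x * f (phi x)}.
  by split=> /= H'; move: H' vw; apply: filterS2 => x /= ->.
move: (pw fg) weight_support; apply: filterS2 => x /= gx an0.
rewrite /v /phase_weight /b; have [->|w_n0] := eqVneq (w x) 0.
  by rewrite mulr0 !mul0r.
rewrite gx// mulrAC mulrA -rmorphM/= mulVf ?an0// rmorph1 mul1r mulrC//.
Qed.

Lemma eta_ae : {ae mu, forall x, w x != 0 -> Defs.eta H phi w x = a x * b (phi x)}.
Proof.
move: Ha (pw Ha) weight_support; apply: filterS3 => x Hx Hpx an0 w_n0.
rewrite /Defs.eta (negbTE w_n0) Hx Hpx// inver sqrf_eq0 (negbTE (an0 w_n0)) -EFinM/=.
by rewrite -exprVn -exprMn sqrtr_sqr ger0_norm// mulr_ge0// invr_ge0.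
Qed.

Let mean_weight_ae (lambda : R) f p q s :
  wcomp mu phi w (f, p) -> wcomp mu phi v (f, q) -> mulop mu a (q, s) ->
  {ae mu, forall x, lambda%:C * p x + (1 - lambda)%:C * s x =
                    mean_weight lambda H phi w x * f (phi x)}.
Proof.
move=> fp fq qs; move: (ae_and fp fq) qs eta_ae; apply: filterS3 => x /= [-> ->] -> etax.
rewrite /mean_weight /v /phase_weight; have [->|/etax ->] := eqVneq (w x) 0.
  by rewrite !(mulr0, mul0r) addr0.
rewrite !(rmorphD, rmorphB, rmorphM, rmorph1)/=; ring.
Qed.

Let L2_weighted_sfE f : L2_weighted mu (sfE H h G) f <->
  exists s, {ae mu, forall x, s x = (a x)%:C * (v x * f (phi x))}.
Proof.
split=> [fs|[s sE]].
  by apply: L2_exists => //; rewrite integral_modulus_phase.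
rewrite /L2_weighted/= -integral_modulus_phase.
by rewrite -(hsq_aeE _ sE) ?ltry.
Qed.

Let mean_component_exists (lambda : R) f :
  op_dom (mulop mu a) f -> L2_weighted mu (sfE H h G) f ->
  exists2 z : L2 mu, mean_component lambda (mulop mu a) (wcomp mu phi v) (f, z) &
    {ae mu, forall x, z x = mean_weight lambda H phi w x * f (phi x)}.
Proof.
move=> [g fg] /L2_weighted_sfE[s sE].
have [p gp] : op_dom (wcomp mu phi v) g by rewrite phase_dom.
have [q fq] : op_dom (wcomp mu phi v) f by rewrite phase_dom.
have qs : mulop mu a (q, s) by move: sE fq; apply: filterS2 => x /= -> ->.
exists (lambda%:C *: p + (1 - lambda)%:C *: s).
  exists (lambda%:C *: p), ((1 - lambda)%:C *: s); split => //.
  - by exists p => //; exists g.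
  - by exists s => //; exists q.
have fp := (phase_modulusP p fg).1 gp.
move: (mean_weight_ae lambda fp fq qs) (L2_linE lambda%:C p ((1 - lambda)%:C *: s))
  (L2_scaleE (1 - lambda)%:C s).
by apply: filterS3 => x <- -> ->.
Qed.

(** The domain of [U A] is that of [A], since [U] is everywhere defined; the
    domain of [A U] is the weighted space of [integral_modulus_phase]. *)
Lemma mean_componentP (lambda : R) f z :
  mean_component lambda (mulop mu a) (wcomp mu phi v) (f, z) <->
  [/\ op_dom (mulop mu a) f, L2_weighted mu (sfE H h G) f &
      {ae mu, forall x, z x = mean_weight lambda H phi w x * f (phi x)}].
Proof.
split; last first.
  move=> [fA fE zE]; have [z' fz' z'E] := mean_component_exists lambda fA fE.
  by have -> : z = z' by apply/L2_eqP; move: zE z'E; apply: filterS2 => x -> ->.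
move=> [y [y' [/= [p [g fg gp] /= ->] [s [q fq qs] /= ->] zE]]]; split.
- by exists g.
- apply/L2_weighted_sfE; exists s; move: fq qs.
  by apply: filterS2 => x /= -> ->.
have fp := (phase_modulusP p fg).1 gp.
move: (mean_weight_ae lambda fp fq qs) (L2_linE lambda%:C p ((1 - lambda)%:C *: s))
  (L2_scaleE (1 - lambda)%:C s).
by rewrite zE; apply: filterS3 => x <- -> ->.
Qed.

Lemma mean_component_dom (lambda : R) f :
  op_dom (mean_component lambda (mulop mu a) (wcomp mu phi v)) f <->
  op_dom (mulop mu a) f /\ L2_weighted mu (sfE H h G) f.
Proof.
split=> [[z /mean_componentP[]]//|[fA fE]].
by have [z fz _] := mean_component_exists lambda fA fE; exists z.
Qed.

(** Where [G] is infinite [h] cannot vanish, so the factor [h / H] is positive. *)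
Lemma sfE_lty : {ae mu, forall x, (sfE H h G x < +oo)%E <-> (G x < +oo)%E}.
Proof.
have [_ _ hG _] := GP; move: Ha hG; apply: filterS2 => x Hx hGx.
have hx : h x = (fine (h x))%:E by apply: h_fin; rewrite Hx.
rewrite sfE_fine; split=> [|Gx]; last first.
  by rewrite lte_mul_pinfty ?ge0_fin_numE ?lee_fin ?divr_ge0 ?fine_ge0 ?ltry.
apply: contraLR; rewrite -!leNgt !leye_eq => /eqP Gx; rewrite Gx.
rewrite gt0_mulye// lte_fin lt_neqAle eq_sym divr_ge0 ?fine_ge0// andbT.
have fh_n0 : fine (h x) != 0.
  by apply/eqP => fh; have := hGx; rewrite hx fh Gx => /(_ erefl).
rewrite mulf_neq0// invr_eq0; apply: contraNN fh_n0 => /eqP fH.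
have Hfin : H x \is a fin_num by rewrite Hx.
by rewrite eq_le fine_ge0// andbT -lee_fin -hx -fH fineK.
Qed.

(** The mean weight is [(lambda + (1 - lambda) eta) w] with both summands
    nonnegative, so it bounds [lambda |w|] and [(1 - lambda) eta |w|]. *)
Lemma mean_weight_dom (lambda : R) f z : 0 < lambda < 1 ->
  wcomp mu phi (mean_weight lambda H phi w) (f, z) ->
  op_dom (wcomp mu phi w) f /\ L2_weighted mu (sfE H h G) f.
Proof.
move=> /andP[l0 l1] fz; have l1' : 0 < 1 - lambda by rewrite subr_gt0.
have eta0 x : 0 <= Defs.eta H phi w x by rewrite /Defs.eta; case: ifP; rewrite ?sqrtr_ge0.
have bound (k : R) (t : X -> R[i]) : 0 < k -> cmeasurable t ->
    {ae mu, forall x, w x != 0 -> exists r : R,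
       [/\ 0 <= r, k * r <= Defs.eta H phi w x + lambda * (1 - Defs.eta H phi w x) &
        t x = r%:C * (w x * f (phi x))]} ->
    {ae mu, forall x, w x = 0 -> t x = 0} ->
    exists s, {ae mu, forall x, s x = t x}.
  move=> k0 mt tE tE0; apply: (@L2_dominated _ _ _ mu t z (k ^- 2)) => //.
    by rewrite invr_ge0 sqr_ge0.
  move: tE tE0 fz; apply: filterS3 => x tE tE0 /= ->.
  have [/tE0 ->|/tE[r [r0 kr ->]]] := eqVneq (w x) 0.
    by rewrite sqnorm0 mulr_ge0 ?sqnorm_ge0// invr_ge0 sqr_ge0.
  rewrite ler_pdivlMl ?exprn_gt0// /mean_weight -[X in _ <= sqnorm X]mulrA !sqnormM !sqnormR.
  rewrite [X in X <= _]mulrA -exprMn ler_wpM2r ?mulr_ge0 ?sqnorm_ge0//.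
  by rewrite lerXn2r// nnegrE; [rewrite mulr_ge0// ltW|rewrite (le_trans _ kr)// mulr_ge0// ltW].
split.
  apply: (bound lambda (fun x => w x * f (phi x))) => //.
  - by apply: cmeasurableM => //; exact/(cmeasurable_comp mphi)/L2_measurable.
  - apply: nearW => x _; exists 1; rewrite mul1r mulr1; split => //.
    have := eta0 x; move: (Defs.eta _ _ _ _) => r r0; nra.
  - by apply: nearW => x ->; rewrite mul0r.
apply/L2_weighted_sfE; apply: (bound (1 - lambda)) => //.
- apply: filterS eta_ae => x etax w0; exists (a x * b (phi x)); split.
  + by rewrite mulr_ge0// invr_ge0.
  + rewrite etax//; move: (a x * _) (eta0 x) => r _; lra.
  + by rewrite /v /phase_weight !rmorphM/= !mulrA.
- by apply: nearW => x w0; rewrite /v /phase_weight w0 mulr0 mul0r mulr0.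
Qed.

End spherical_component.

(** * The pair: modulus, phase and spherical mean transform *)

Section mulop_weighted.
Context {R : realType} {d : measure_display} {X : measurableType d}.
Variable mu : {measure set X -> \bar R}.
Variable a : X -> R.
Hypothesis ma : measurable_fun setT a.

Let RN_mulop : is_RN_derivative mu
  (pushforward (wmeasure mu (cmeasurable_real ma)) id) (fun x => (a x ^+ 2)%:E).
Proof.
split; first by apply/measurable_EFinP; exact: measurable_funX.
  by move=> x; rewrite lee_fin sqr_ge0.
by move=> D mD; apply: eq_integral => x _; rewrite sqnormR.
Qed.

(** [mulop mu a] is convertible to the weighted composition operator of the
    identity map with weight [a]. *)
Lemma mulop_dom : op_dom (mulop mu a) = L2_weighted mu (fun x => (a x ^+ 2)%:E).
Proof. exact: (wcomp_dom (@measurable_id _ _ setT) RN_mulop). Qed.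

Lemma mulop_hsq f g : mulop mu a (f, g) ->
  ((hsq g)%:E = \int[mu]_x ((sqnorm (f x))%:E * (a x ^+ 2)%:E))%E.
Proof. exact: (wcomp_hsq (@measurable_id _ _ setT) RN_mulop). Qed.

End mulop_weighted.

Section weighted_sums.
Context {R : realType} {d : measure_display} {X : measurableType d}.
Variable mu : {measure set X -> \bar R}.
Implicit Types (f : L2 mu) (r s : X -> \bar R).

Lemma integral_weightD f r s : measurable_fun setT r -> measurable_fun setT s ->
  (forall x, 0 <= r x)%E -> (forall x, 0 <= s x)%E ->
  (\int[mu]_x ((sqnorm (f x))%:E * (r x + s x)) =
   \int[mu]_x ((sqnorm (f x))%:E * r x) + \int[mu]_x ((sqnorm (f x))%:E * s x))%E.
Proof.
move=> mr ms r0 s0; have mf := emeasurable_sqnorm (L2_measurable f).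
under eq_integral do rewrite ge0_muleDr//.
by apply: ge0_integralD => //;
  [move=> x _; rewrite mule_ge0// lee_fin sqnorm_ge0|exact: emeasurable_funM
  |move=> x _; rewrite mule_ge0// lee_fin sqnorm_ge0|exact: emeasurable_funM].
Qed.

Lemma L2_weightedD f r s : measurable_fun setT r -> measurable_fun setT s ->
  (forall x, 0 <= r x)%E -> (forall x, 0 <= s x)%E ->
  L2_weighted mu (fun x => r x + s x)%E f <->
  L2_weighted mu r f /\ L2_weighted mu s f.
Proof.
move=> mr ms r0 s0; rewrite /L2_weighted/= integral_weightD//.
have ge0 t : (forall x, 0 <= t x)%E -> (0 <= \int[mu]_x ((sqnorm (f x))%:E * t x))%E.
  by move=> t0; apply: integral_ge0 => x _; rewrite mule_ge0// lee_fin sqnorm_ge0.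
split=> [rs|[fr fs]]; last exact: lte_add_pinfty.
by split; apply: le_lt_trans rs; rewrite ?leeDl ?leeDr ?ge0.
Qed.

Lemma L2_weighted1 f : L2_weighted mu (cst 1%E) f.
Proof. by rewrite /L2_weighted/=; under eq_integral do rewrite mule1; exact: L2_fin. Qed.

Lemma eq_L2_weighted r s : measurable_fun setT r -> measurable_fun setT s ->
  (forall x, 0 <= r x)%E -> (forall x, 0 <= s x)%E ->
  {ae mu, forall x, r x = s x} -> L2_weighted mu r = L2_weighted mu s.
Proof.
move=> mr ms r0 s0 rs; apply/seteqP.
suff key (f : L2 mu) : (\int[mu]_x ((sqnorm (f x))%:E * r x) = \int[mu]_x ((sqnorm (f x))%:E * s x))%E.
  by split=> f; rewrite /L2_weighted/= key.
have mf := emeasurable_sqnorm (L2_measurable f).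
apply: ge0_ae_eq_integral => //.
- exact: emeasurable_funM.
- exact: emeasurable_funM.
- by move=> x _; rewrite mule_ge0// lee_fin sqnorm_ge0.
- by move=> x _; rewrite mule_ge0// lee_fin sqnorm_ge0.
by apply: filterS rs => x ->.
Qed.

End weighted_sums.

Section pair_of_weighted_compositions.
Context {R : realType} {d : measure_display} {X : measurableType d}.
Variable mu : {measure set X -> \bar R}.
Variables (phi1 phi2 : X -> X) (w1 w2 : X -> R[i]).
Hypotheses (mphi1 : measurable_fun setT phi1) (mphi2 : measurable_fun setT phi2).
Hypotheses (mw1 : cmeasurable w1) (mw2 : cmeasurable w2).
Hypotheses (pw1 : null_preserving mu phi1 w1) (pw2 : null_preserving mu phi2 w2).
Variables h1 h2 : X -> \bar R.
Hypothesis h1P : is_RN_derivative mu (pushforward (wmeasure mu mw1) phi1) h1.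
Hypothesis h2P : is_RN_derivative mu (pushforward (wmeasure mu mw2) phi2) h2.
Hypothesis h1_fin : {ae mu, forall x, (h1 x < +oo)%E}.
Hypothesis h2_fin : {ae mu, forall x, (h2 x < +oo)%E}.
Implicit Types f g : L2 mu.

Let H x := (h1 x + h2 x)%E.
Let a x := Num.sqrt (fine (H x)).
Let T := column (wcomp mu phi1 w1) (wcomp mu phi2 w2).
Let U := column (wcomp mu phi1 (phase_weight phi1 w1 a))
                (wcomp mu phi2 (phase_weight phi2 w2 a)).

Let mh1 : measurable_fun setT h1. Proof. by case: h1P. Qed.
Let mh2 : measurable_fun setT h2. Proof. by case: h2P. Qed.
Let h1_ge0 x : (0 <= h1 x)%E. Proof. by case: h1P. Qed.
Let h2_ge0 x : (0 <= h2 x)%E. Proof. by case: h2P. Qed.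
Let mH : measurable_fun setT H. Proof. exact: emeasurable_funD. Qed.
Let H_ge0 x : (0 <= H x)%E. Proof. exact: adde_ge0. Qed.
Let h1_le x : (h1 x <= H x)%E. Proof. by rewrite leeDl. Qed.
Let h2_le x : (h2 x <= H x)%E. Proof. by rewrite leeDr. Qed.
Let a_ge0 x : 0 <= a x. Proof. exact: sqrtr_ge0. Qed.

Let ma : measurable_fun setT a.
Proof.
apply: (measurableT_comp (continuous_measurable_fun (@sqrt_continuous R))).
by apply: measurableT_comp => //; exact: measurable_fine.
Qed.

Lemma sqrt_densityE : {ae mu, forall x, H x = (a x ^+ 2)%:E}.
Proof.
move: h1_fin h2_fin; apply: filterS2 => x h1x h2x.
rewrite /a sqr_sqrtr ?fine_ge0// fineK// ge0_fin_numE//.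
exact: lte_add_pinfty.
Qed.
Let Ha := sqrt_densityE.

Let sA := mulop_selfadjoint mu ma a_ge0.

Let a2_ge0 x : (0 <= (a x ^+ 2)%:E)%E. Proof. by rewrite lee_fin sqr_ge0. Qed.
Let ma2 : measurable_fun setT (fun x => (a x ^+ 2)%:E).
Proof. by apply/measurable_EFinP; exact: measurable_funX. Qed.

Lemma modulus_dom f : op_dom (mulop mu a) f <->
  L2_weighted mu h1 f /\ L2_weighted mu h2 f.
Proof.
rewrite mulop_dom// -(eq_L2_weighted mH ma2 H_ge0 a2_ge0 Ha).
exact: L2_weightedD.
Qed.

Lemma column_dom : op_dom T = op_dom (mulop mu a).
Proof.
apply/seteqP; split=> f.
  move=> [[y z] [/= fy fz]]; apply/modulus_dom; split.
    by rewrite -(wcomp_dom mphi1 h1P); exists y.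
  by rewrite -(wcomp_dom mphi2 h2P); exists z.
move=> /modulus_dom[]; rewrite -(wcomp_dom mphi1 h1P) -(wcomp_dom mphi2 h2P).
by move=> [y fy] [z fz]; exists (y, z).
Qed.

Lemma column_hsq f g z : mulop mu a (f, g) -> T (f, z) -> hsq g = hsq z.
Proof.
move=> fg [/= fz1 fz2]; apply: EFin_inj; rewrite hsq_pair EFinD.
rewrite (wcomp_hsq mphi1 h1P fz1) (wcomp_hsq mphi2 h2P fz2) -integral_weightD//.
rewrite (mulop_hsq ma fg).
have mf := emeasurable_sqnorm (L2_measurable f).
apply: ge0_ae_eq_integral => //.
- exact: emeasurable_funM.
- exact: emeasurable_funM.
- by move=> x _; rewrite mule_ge0 ?adde_ge0 ?lee_fin ?sqnorm_ge0 ?sqr_ge0.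
- by move=> x _; rewrite mule_ge0 ?adde_ge0 ?lee_fin ?sqnorm_ge0 ?sqr_ge0.
by apply: filterS Ha => x <-.
Qed.

Let lT : linear_op T.
Proof. by apply: column_linear; exact: wcomp_linear. Qed.

Lemma modulus_column : modulus T = mulop mu a.
Proof.
have TA : op_comp (mulop mu a) (mulop mu a) = op_comp (adjoint T) T.
  by apply: adjoint_comp_square => //; [rewrite column_dom|exact: column_hsq].
apply: modulus_unique; first by split => //; exact: mulop_positive.
by move=> B [sB pB BB]; apply: mulop_root_unique => //; rewrite BB TA.
Qed.

Let N := [set x | a x != 0].

Let mN : measurable N.
Proof.
have -> : N = ~` [set x | a x = 0] by apply/seteqP; split=> x /eqP.
apply: measurableC; rewrite -[X in measurable X]setTI.
exact: (ma measurableT (measurable_set1 0)).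
Qed.

(** The densities [a^-2 h1] and [a^-2 h2] add up to the indicator of [a != 0]. *)
Lemma phase_column_hsq f z : U (f, z) -> hsq z = hsq (cutoff N f).
Proof.
move=> [/= fz1 fz2]; apply: EFin_inj; rewrite hsq_pair EFinD.
rewrite (phase_hsq mphi1 h1P ma a_ge0 fz1) (phase_hsq mphi2 h2P ma a_ge0 fz2).
have mb2 : measurable_fun setT (fun x => ((a x)^-1 ^+ 2)%:E).
  by apply/measurable_EFinP; apply: measurable_funX; exact: measurable_funV.
have b2_ge0 x : (0 <= ((a x)^-1 ^+ 2)%:E)%E by rewrite lee_fin sqr_ge0.
rewrite -integral_weightD//; [|exact: emeasurable_funM|exact: emeasurable_funM
  |by move=> x; rewrite mule_ge0|by move=> x; rewrite mule_ge0].
rewrite hsqE; have mf := emeasurable_sqnorm (L2_measurable f).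
apply: ge0_ae_eq_integral => //.
- by apply: emeasurable_funM => //; apply: emeasurable_funD; exact: emeasurable_funM.
- exact/emeasurable_sqnorm/L2_measurable.
- by move=> x _; rewrite mule_ge0 ?lee_fin ?sqnorm_ge0// adde_ge0// mule_ge0.
- by move=> x _; rewrite lee_fin sqnorm_ge0.
move: Ha (cutoffE f mN); apply: filterS2 => x Hx -> _.
rewrite -ge0_muleDr// -[(h1 x + h2 x)%E]/(H x) Hx -!EFinM sqnormM indic_toC sqnormR indicE.
congr EFin; rewrite mulrC -exprMn; congr (_ ^+ 2 * _).
have [/[!inE] an0|] := boolP (x \in N); first by rewrite mulVf.
by rewrite notin_setE /N /= => /negP; rewrite negbK => /eqP ->; rewrite mulr0.
Qed.

Let lU : linear_op U.
Proof.
by apply: column_linear; apply: wcomp_linear; exact: phase_weight_null_preserving.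
Qed.

Let dU1 : op_dom (wcomp mu phi1 (phase_weight phi1 w1 a)) = setT.
Proof. exact: (phase_dom mphi1 h1P ma a_ge0 Ha h1_le). Qed.

Let dU2 : op_dom (wcomp mu phi2 (phase_weight phi2 w2 a)) = setT.
Proof. exact: (phase_dom mphi2 h2P ma a_ge0 Ha h2_le). Qed.

Lemma phase_column_dom : op_dom U = setT.
Proof.
apply/seteqP; split=> // f _.
have [y fy] : op_dom (wcomp mu phi1 (phase_weight phi1 w1 a)) f by rewrite dU1.
have [z fz] : op_dom (wcomp mu phi2 (phase_weight phi2 w2 a)) f by rewrite dU2.
by exists (y, z).
Qed.

Lemma ker_phase_column f : op_ker U f <-> cutoff N f = 0.
Proof.
split=> [fU|f0].
  by apply: hsq_eq0; rewrite -(phase_column_hsq fU) /hsq linear0l.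
have [z fz] : op_dom U f by rewrite phase_column_dom.
have z0 : z = 0 by apply: hsq_eq0; rewrite (phase_column_hsq fz) f0 /hsq linear0l.
by rewrite z0 in fz.
Qed.

Lemma ker_column f : op_ker T f <-> cutoff N f = 0.
Proof.
split=> [fT|f0].
  have [y fy] : op_dom (mulop mu a) f by rewrite -column_dom; exists 0.
  have y0 : y = 0 by apply: hsq_eq0; rewrite (column_hsq fy fT) /hsq linear0l.
  apply/L2_eqP; move: fy (cutoffE f mN) (L2_0E mu); rewrite y0.
  apply: filterS3 => x /= + -> x0; rewrite x0 indicE => /esym/eqP.
  rewrite mulf_eq0 fmorph_eq0.
  have [/[!inE] /negbTE -> /= /eqP ->|_ _] := boolP (x \in N); first by rewrite mulr0.
  by rewrite mul0r.
have fA0 : mulop mu a (f, 0).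
  move: (cutoff_eq0 mN f0) (L2_0E mu); apply: filterS2 => x fx /= ->.
  by have [->|/fx ->] := eqVneq (a x) 0; rewrite ?mul0r ?mulr0.
have [z fz] : op_dom T f by rewrite column_dom; exists 0.
have z0 : z = 0 by apply: hsq_eq0; rewrite -(column_hsq fA0 fz) /hsq linear0l.
by rewrite z0 in fz.
Qed.

Lemma phase_column_is_phase : is_phase T U.
Proof.
split.
- split => //; first exact: phase_column_dom.
    exists 1 => f z /phase_column_hsq fz; rewrite mul1r /hnorm -!/(hsq _) fz.
    rewrite ler_wsqrtr//.
    by have := hsq_ge0 (f - cutoff N f); rewrite hsqB_cutoff// subr_ge0.
  move=> f z fU /phase_column_hsq fz; rewrite /hnorm -!/(hsq _) fz; congr (Num.sqrt _).
  have := hsqB_cutoff f mN.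
  suff -> : f - cutoff N f = 0 by rewrite /hsq linear0l => /eqP; rewrite eq_sym subr_eq0 => /eqP.
  apply: hsq_eq0; rewrite /hsq innerBl fU.
    rewrite (_ : inner (cutoff N f) _ = 0) ?subrr//; apply: inner_ae0.
    move: (cutoffE f mN) (L2_subE f (cutoff N f)); apply: filterS2 => x + ->.
    by move=> ->; rewrite indicE; case: (x \in N);
       rewrite ?mul1r ?subrr ?rmorph0 ?mulr0// !mul0r.
  apply/ker_phase_column/L2_eqP; move: (cutoffE f mN) (cutoffE (f - cutoff N f) mN)
    (ae_and (L2_subE f (cutoff N f)) (L2_0E mu)); apply: filterS3 => x fx -> [-> ->].
  by rewrite fx indicE; case: (x \in N); rewrite ?mul1r ?subrr// mul0r.
- by apply/seteqP; split=> f; rewrite ker_phase_column ker_column.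
- rewrite modulus_column; apply/seteqP; split=> -[f [z1 z2]].
    move=> Tz; have [g fg] : op_dom (mulop mu a) f by rewrite -column_dom; exists (z1, z2).
    exists g => //; case: Tz => /= Tz1 Tz2; split => /=.
      exact/(phase_modulusP mphi1 pw1 h1P ma Ha h1_le _ fg).
    exact/(phase_modulusP mphi2 pw2 h2P ma Ha h2_le _ fg).
  move=> [g /= fg [/= gz1 gz2]]; split => /=.
    exact/(phase_modulusP mphi1 pw1 h1P ma Ha h1_le _ fg).
  exact/(phase_modulusP mphi2 pw2 h2P ma Ha h2_le _ fg).
Qed.

(** To approximate [f] by elements of [ker T + ran |T|], truncate it to
    [a^-1 <= n], that is, to [a = 0] together with [a >= 1/n]. *)
Lemma phase_column : phase T = U.
Proof.
have mb : measurable_fun setT (fun x => (a x)^-1) by exact: measurable_funV.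
apply: phase_unique; first exact: phase_column_is_phase.
  by rewrite modulus_column; exact: selfadjoint_linear.
apply/seteqP; split=> // f _; apply/hclosureP => e e0.
have [n fn] := cutoff_approx f mb e0.
pose u : L2 mu := cutoff (sublevel (fun x => (a x)^-1) n) f.
have uE : {ae mu, forall x, u x != 0 -> (a x)^-1 <= n%:R} := cutoff_sublevel_support mb f n.
exists u => //.
have [|g gE] := @mulop_bounded_support _ _ _ mu (fun x => (a x)^-1) mb _ u n%:R uE.
  by move=> x; rewrite invr_ge0.
pose y : L2 mu := cutoff N u; have yE : {ae mu, forall x, y x = \1_N x * u x} := cutoffE u mN.
exists (u - y), g, y; split; first by rewrite subrK.
  apply/ker_column/L2_eqP; move: yE (cutoffE (u - y) mN)
    (ae_and (L2_subE u y) (L2_0E mu)); apply: filterS3 => x yx -> [-> ->].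
  by rewrite yx indicE; case: (x \in N); rewrite ?mul1r ?subrr// mul0r.
(* [y = a (a^-1 u)] is in the range of the modulus since [a^-1 <= n] on the
   support of [u]. *)
rewrite modulus_column; move: yE gE; apply: filterS2 => x /= -> ->.
rewrite mulrA -rmorphM/= indicE.
have [/[!inE] an0|] := boolP (x \in N); first by rewrite mulfV.
by rewrite notin_setE /N /= => /negP; rewrite negbK => /eqP ->; rewrite !mul0r.
Qed.

(** Each component of the column can be read off separately because the other
    one is everywhere defined. *)
Lemma spherical_mean_transformE lambda : spherical_mean_transform lambda T =
  column (mean_component lambda (mulop mu a) (wcomp mu phi1 (phase_weight phi1 w1 a)))
         (mean_component lambda (mulop mu a) (wcomp mu phi2 (phase_weight phi2 w2 a))).
Proof.
rewrite /spherical_mean_transform modulus_column phase_column.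
have -> : component1 U = wcomp mu phi1 (phase_weight phi1 w1 a).
  apply/seteqP; split=> -[f y]; first by move=> [z []].
  move=> fy; have [z fz] : op_dom (wcomp mu phi2 (phase_weight phi2 w2 a)) f by rewrite dU2.
  by exists z.
have -> // : component2 U = wcomp mu phi2 (phase_weight phi2 w2 a).
apply/seteqP; split=> -[f z]; first by move=> [y []].
move=> fz; have [y fy] : op_dom (wcomp mu phi1 (phase_weight phi1 w1 a)) f by rewrite dU1.
by exists y.
Qed.

Variables (E1 E2 G1 G2 : X -> \bar R).
Hypothesis E1P : is_cond_expectation (wmeasure mu mw1) phi1 H E1.
Hypothesis E2P : is_cond_expectation (wmeasure mu mw2) phi2 H E2.
Hypothesis G1P : is_pullback mu (wmeasure mu mw1) phi1 h1 E1 G1.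
Hypothesis G2P : is_pullback mu (wmeasure mu mw2) phi2 h2 E2 G2.
Variable lambda : R.

Let M := spherical_mean_transform lambda T.
Let C := column (wcomp mu phi1 (mean_weight lambda H phi1 w1))
                (wcomp mu phi2 (mean_weight lambda H phi2 w2)).
Let rho x := (1 + ((h1 x + sfE H h1 G1 x) + (h2 x + sfE H h2 G2 x)))%E.

Let ms1 := measurable_sfE h1P mH H_ge0 G1P h1_le.
Let ms2 := measurable_sfE h2P mH H_ge0 G2P h2_le.
Let s1_ge0 := sfE_ge0 h1P H_ge0 G1P h1_le.
Let s2_ge0 := sfE_ge0 h2P H_ge0 G2P h2_le.
Let mean1P := mean_componentP mphi1 pw1 h1P mH H_ge0 E1P G1P ma a_ge0 Ha h1_le lambda.
Let mean2P := mean_componentP mphi2 pw2 h2P mH H_ge0 E2P G2P ma a_ge0 Ha h2_le lambda.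
Let mean1_dom := mean_component_dom mphi1 pw1 h1P mH H_ge0 E1P G1P ma a_ge0 Ha h1_le lambda.
Let mean2_dom := mean_component_dom mphi2 pw2 h2P mH H_ge0 E2P G2P ma a_ge0 Ha h2_le lambda.

Let mhs1 : measurable_fun setT (fun x => h1 x + sfE H h1 G1 x)%E.
Proof. exact: emeasurable_funD mh1 ms1. Qed.
Let mhs2 : measurable_fun setT (fun x => h2 x + sfE H h2 G2 x)%E.
Proof. exact: emeasurable_funD mh2 ms2. Qed.
Let hs1_ge0 x : (0 <= h1 x + sfE H h1 G1 x)%E.
Proof. by rewrite adde_ge0 ?s1_ge0. Qed.
Let hs2_ge0 x : (0 <= h2 x + sfE H h2 G2 x)%E.
Proof. by rewrite adde_ge0 ?s2_ge0. Qed.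
Let mhs12 := emeasurable_funD mhs1 mhs2.
Let hs12_ge0 x : (0 <= (h1 x + sfE H h1 G1 x) + (h2 x + sfE H h2 G2 x))%E.
Proof. exact: adde_ge0. Qed.
Let mrho : measurable_fun setT rho.
Proof. exact: emeasurable_funD (measurable_cst 1%E) mhs12. Qed.
Let rho_ge0 x : (0 <= rho x)%E. Proof. exact: adde_ge0. Qed.

Lemma spherical_mean_dom : op_dom M = L2_weighted mu rho.
Proof.
have rhoP f : L2_weighted mu rho f <->
    [/\ op_dom (mulop mu a) f, L2_weighted mu (sfE H h1 G1) f & L2_weighted mu (sfE H h2 G2) f].
  have e0 : L2_weighted mu rho f <-> _ :=
    L2_weightedD f (measurable_cst 1%E) mhs12 (fun=> lee01) hs12_ge0.
  have e12 := L2_weightedD f mhs1 mhs2 hs1_ge0 hs2_ge0.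
  have e1 := L2_weightedD f mh1 ms1 h1_ge0 s1_ge0.
  have e2 := L2_weightedD f mh2 ms2 h2_ge0 s2_ge0.
  have eA := modulus_dom f; have one := L2_weighted1 f.
  split=> [/e0[_ /e12[/e1[f1 f2] /e2[f3 f4]]]|[/eA[f1 f3] f2 f4]].
    by split => //; exact/eA.
  by apply/e0; split => //; apply/e12; split; [apply/e1|apply/e2].
rewrite /M spherical_mean_transformE; apply/seteqP; split=> f.
  move=> [[z1 z2] [/= /mean1P[fA f1 _] /mean2P[_ f2 _]]]; exact/rhoP.
move=> /rhoP[fA f1 f2].
have [z1 fz1] : op_dom (mean_component lambda (mulop mu a)
    (wcomp mu phi1 (phase_weight phi1 w1 a))) f by apply/mean1_dom.
have [z2 fz2] : op_dom (mean_component lambda (mulop mu a)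
    (wcomp mu phi2 (phase_weight phi2 w2 a))) f by apply/mean2_dom.
by exists (z1, z2).
Qed.

Let rho_lty : {ae mu, forall x, (rho x < +oo)%E <-> (G1 x + G2 x < +oo)%E}.
Proof.
have addE (r s : \bar R) : (0 <= r)%E -> (0 <= s)%E ->
    (r + s < +oo)%E <-> (r < +oo)%E /\ (s < +oo)%E.
  move=> r0 s0; split=> [rs|[]]; last exact: lte_add_pinfty.
  by split; apply: le_lt_trans rs; rewrite ?leeDl ?leeDr.
have [_ G1_ge0 _ _] := G1P; have [_ G2_ge0 _ _] := G2P.
move: (ae_and h1_fin h2_fin)
  (sfE_lty h1P H_ge0 G1P Ha h1_le) (sfE_lty h2P H_ge0 G2P Ha h2_le).
apply: filterS3 => x [h1x h2x] s1 s2.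
have e0 := addE _ _ lee01 (hs12_ge0 x); have e12 := addE _ _ (hs1_ge0 x) (hs2_ge0 x).
have e1 := addE _ _ (h1_ge0 x) (s1_ge0 x); have e2 := addE _ _ (h2_ge0 x) (s2_ge0 x).
have eG := addE _ _ (G1_ge0 x) (G2_ge0 x); have one : (1%E < +oo :> \bar R)%E by rewrite ltry.
rewrite /rho; tauto.
Qed.

Lemma spherical_mean_closure :
  hclosure (op_dom M) = L2_on mu [set x | (G1 x + G2 x < +oo)%E].
Proof.
by rewrite spherical_mean_dom hclosure_L2_weighted//; exact: L2_on_ae.
Qed.

Lemma spherical_mean_orthocomp :
  orthocomp (op_dom M) = L2_on mu [set x | (G1 x + G2 x = +oo)%E].
Proof.
rewrite spherical_mean_dom orthocomp_L2_weighted//; apply: L2_on_ae.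
apply: filterS rho_lty => x /= rG.
have yE (r : \bar R) : r = +oo%E <-> ~ (r < +oo)%E.
  by rewrite ltey; split=> [->|/negP]; [rewrite eqxx|rewrite negbK => /eqP].
by rewrite !yE rG.
Qed.

Lemma spherical_mean_sub : M `<=` C.
Proof.
by rewrite /M spherical_mean_transformE => -[f z] [/= /mean1P[_ _ z1] /mean2P[_ _ z2]].
Qed.

Lemma spherical_mean_eq : 0 < lambda < 1 -> M = C.
Proof.
move=> l01; apply/seteqP; split; first exact: spherical_mean_sub.
rewrite /M spherical_mean_transformE => -[f z] [/= fz1 fz2].
have [[y1 fy1] fs1] := mean_weight_dom mphi1 pw1 h1P mH H_ge0 E1P G1P ma a_ge0 Ha h1_le l01 fz1.
have [[y2 fy2] fs2] := mean_weight_dom mphi2 pw2 h2P mH H_ge0 E2P G2P ma a_ge0 Ha h2_le l01 fz2.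
have fA : op_dom (mulop mu a) f by rewrite -column_dom; exists (y1, y2).
by split; [apply/mean1P|apply/mean2P].
Qed.

End pair_of_weighted_compositions.

Theorem theorem13 (R : realType) (d : measure_display) (X : measurableType d)
    (mu : {measure set X -> \bar R}) (mu_sigma_finite : sigma_finite setT mu)
    (phi1 phi2 : X -> X) (w1 w2 : X -> R[i])
    (mphi1 : measurable_fun setT phi1) (mphi2 : measurable_fun setT phi2)
    (mw1 : cmeasurable w1) (mw2 : cmeasurable w2)
    (ac1 : pushforward (wmeasure mu mw1) phi1 `<< mu)
    (ac2 : pushforward (wmeasure mu mw2) phi2 `<< mu)
    (dense1 : hdense (op_dom (wcomp mu phi1 w1)))
    (dense2 : hdense (op_dom (wcomp mu phi2 w2)))
    (h1 h2 : X -> \bar R)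
    (h1P : is_RN_derivative mu (pushforward (wmeasure mu mw1) phi1) h1)
    (h2P : is_RN_derivative mu (pushforward (wmeasure mu mw2) phi2) h2)
    (E1 E2 G1 G2 : X -> \bar R)
    (E1P : is_cond_expectation (wmeasure mu mw1) phi1
             (fun x => h1 x + h2 x)%E E1)
    (E2P : is_cond_expectation (wmeasure mu mw2) phi2
             (fun x => h1 x + h2 x)%E E2)
    (G1P : is_pullback mu (wmeasure mu mw1) phi1 h1 E1 G1)
    (G2P : is_pullback mu (wmeasure mu mw2) phi2 h2 E2 G2)
    (lambda : R) (lambda01 : 0 <= lambda <= 1) :
  let H := (fun x => h1 x + h2 x)%E in
  let M := spherical_mean_transform lambda
             (column (wcomp mu phi1 w1) (wcomp mu phi2 w2)) in
  let C := column (wcomp mu phi1 (mean_weight lambda H phi1 w1))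
                  (wcomp mu phi2 (mean_weight lambda H phi2 w2)) in
  [/\ op_dom M = L2_weighted mu (fun x =>
        1 + ((h1 x + sfE H h1 G1 x) + (h2 x + sfE H h2 G2 x)))%E,
      hclosure (op_dom M) = L2_on mu [set x | (G1 x + G2 x < +oo)%E],
      orthocomp (op_dom M) = L2_on mu [set x | (G1 x + G2 x = +oo)%E] &
      (0 < lambda < 1 -> M = C) /\
      ((lambda = 0 \/ lambda = 1) -> M `<=` C)].
Proof.
have pw1 := dominates_null_preserving mphi1 ac1.
have pw2 := dominates_null_preserving mphi2 ac2.
have f1 := dense_RN_finite mphi1 h1P mu_sigma_finite dense1.
have f2 := dense_RN_finite mphi2 h2P mu_sigma_finite dense2.
split; last split.
- exact: (spherical_mean_dom mphi1 mphi2 pw1 pw2 h1P h2P f1 f2 E1P E2P G1P G2P lambda).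
- exact: (spherical_mean_closure mphi1 mphi2 pw1 pw2 h1P h2P f1 f2 E1P E2P G1P G2P lambda).
- exact: (spherical_mean_orthocomp mphi1 mphi2 pw1 pw2 h1P h2P f1 f2 E1P E2P G1P G2P lambda).
- exact: (spherical_mean_eq mphi1 mphi2 pw1 pw2 h1P h2P f1 f2 E1P E2P G1P G2P).
- by move=> _; exact: (spherical_mean_sub mphi1 mphi2 pw1 pw2 h1P h2P f1 f2 E1P E2P G1P G2P).
Qed.
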